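(* For every $D\ge D_{\min}$, the capacity-distortion function of the bistatic ISAC channel satisfies $$C(D)=\lim_{k\to\infty}\frac1k\,\sup_{P_{X^k}}\Big\{ I(X^k;Y^k\mid S^k)\ \Big|\ \mathbb{E}\big[d\big(S^k,\hat S^{*k}(Z^k)\big)\big]\le kD\Big\},$$ where the supremum is over all pmfs $P_{X^k}$ on $\mathcal X^k$, the joint law of $(X^k,S^k,Y^k,Z^k)$ is $P_{X^k}(x^k)\prod_{i=1}^k P_S(s_i)\,p(y_i,z_i|x_i,s_i)$, $d(s^k,\hat s^k)=\sum_{i=1}^k d(s_i,\hat s_i)$, and $\hat S^{*k}(Z^k)=(\hat S_1^*(Z^k),\dots,\hat S_k^*(Z^k))$ with $$\hat S_i^*(z^k)=\arg\min_{s'\in\hat{\mathcal S}}\sum_{s_i\in\mathcal S}p(s_i|z^k)\,d(s_i,s'),\qquad i=1,\dots,k,$$ is the optimal estimator (ties broken arbitrarily).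
   Context: Bistatic ISAC model. $\mathcal X,\mathcal S,\mathcal Y,\mathcal Z,\hat{\mathcal S}$ are finite sets, $P_S$ is a pmf on $\mathcal S$, $p(y,z|x,s)$ is a conditional pmf on $\mathcal Y\times\mathcal Z$ given $(x,s)\in\mathcal X\times\mathcal S$, and $d:\mathcal S\times\hat{\mathcal S}\to\mathbb R_+$ is a (bounded) distortion function. The state sequence $S^n$ is i.i.d. $\sim P_S$ and independent of the message; the channel is memoryless: given $(x^n,s^n)$, $(Y^n,Z^n)$ has pmf $\prod_i p(y_i,z_i|x_i,s_i)$ (no feedback). The communication receiver observes $Y^n$ and knows $S^n$ (noncausally); the sensing receiver observes only $Z^n$ (it knows the codebook but not the message). A $(2^{nR},n)$ code consists of a message set $[1:2^{nR}]=\{1,\dots,\lceil 2^{nR}\rceil\}$, an encoder $w\mapsto x^n(w)\in\mathcal X^n$, a decoder $(y^n,s^n)\mapsto\hat w$, and a state estimator $h:\mathcal Z^n\to\hat{\mathcal S}^n$, $\hat S^n=h(Z^n)$. The message $W$ is uniform on the message set. $P_e^{(n)}=\Pr\{\hat W\ne W\}$ and $D^{(n)}=\frac1n\sum_{i=1}^n\mathbb E[d(S_i,\hat S_i)]$. A pair $(R,D)$ is achievable if there is a sequence of $(2^{nR},n)$ codes with $\lim_n P_e^{(n)}=0$ and $\limsup_n D^{(n)}\le D$. The capacity-distortion function is $C(D)=\max\{R\ge 0:(R,D)\text{ achievable}\}$. $D_{\min}$ is the minimum of $\mathbb E[d(S,\hat s(Z))]$ over all pmfs $P_X$ on $\mathcal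 X$ and all maps $\hat s:\mathcal Z\to\hat{\mathcal S}$, with $(X,S,Y,Z)\sim P_XP_SP_{YZ|XS}$. Information quantities are in bits.
   Formalization: Equality of C(D) with the limit is asserted only for D > D_min; at D = D_min, where equality can fail, only existence of the limit and limit ≤ C(D) are stated; C(D) is read as a supremum of achievable rates, since the maximum need not be attained. *)

(* Defs.v *)
From HB Require Import structures.
From mathcomp Require Import all_boot all_order all_algebra.
From mathcomp Require Import all_classical all_reals all_analysis.

Set Implicit Arguments.
Unset Strict Implicit.
Unset Printing Implicit Defensive.

Import Order.TTheory GRing.Theory Num.Theory.
Import numFieldNormedType.Exports.
Local Open Scope classical_set_scope.
Local Open Scope ring_scope.

Definition is_pmf (R : realType) (T : finType) (p : T -> R) : Prop :=
  (forall t, 0 <= p t) /\ \sum_t p t = 1.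

Definition log2 (R : realType) (x : R) : R := ln x / ln 2.

(* I(A;B|C) in bits for the joint pmf P a b c = Pr(A = a, B = b, C = c), i.e.
   sum of P(a,b,c) log2 (P(a,b,c) P(c) / (P(a,c) P(b,c))); the terms with
   P a b c = 0 vanish whatever the value of the logarithm. *)
Definition cond_mutual_info (R : realType) (A B C : finType)
    (P : A -> B -> C -> R) : R :=
  let PC c := \sum_a \sum_b P a b c in
  let PAC a c := \sum_b P a b c in
  let PBC b c := \sum_a P a b c in
  \sum_a \sum_b \sum_c
    P a b c * log2 (P a b c * PC c / (PAC a c * PBC b c)).

Record bistatic_isac (R : realType) (X S Y Z Sh : finType) := BistaticISAC {
  state_pmf : S -> R;
  state_pmfP : is_pmf state_pmf;
  channel : X -> S -> Y * Z -> R;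
  channelP : forall x s, is_pmf (channel x s);
  dist : S -> Sh -> R;
  dist_ge0 : forall s s', 0 <= dist s s' }.

Section BistaticISAC.
Variables (R : realType) (X S Y Z Sh : finType).
Variable M : bistatic_isac R X S Y Z Sh.

Definition block_channel (k : nat) (x : {ffun 'I_k -> X})
    (s : {ffun 'I_k -> S}) (y : {ffun 'I_k -> Y}) (z : {ffun 'I_k -> Z}) : R :=
  \prod_(i < k) (state_pmf M (s i) * channel M (x i) (s i) (y i, z i)).

Definition block_dist (k : nat) (s : {ffun 'I_k -> S})
    (t : {ffun 'I_k -> Sh}) : R :=
  \sum_(i < k) dist M (s i) (t i).

Definition Dmin : R :=
  inf [set e | exists (p : X -> R) (g : Z -> Sh), is_pmf p /\
    e = \sum_x \sum_s \sum_y \sum_z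
          p x * state_pmf M s * channel M x s (y, z) * dist M s (g z)].

Record code (m n : nat) := Code {
  encoder : 'I_m -> {ffun 'I_n -> X};
  decoder : {ffun 'I_n -> Y} -> {ffun 'I_n -> S} -> 'I_m;
  estimator : {ffun 'I_n -> Z} -> {ffun 'I_n -> Sh} }.

Definition code_law (m n : nat) (c : code m n) (w : 'I_m)
    (s : {ffun 'I_n -> S}) (y : {ffun 'I_n -> Y}) (z : {ffun 'I_n -> Z}) : R :=
  m%:R^-1 * block_channel (encoder c w) s y z.

Definition error_prob (m n : nat) (c : code m n) : R :=
  \sum_w \sum_s \sum_y \sum_z
    code_law c w s y z * (decoder c y s != w)%:R.

Definition code_distortion (m n : nat) (c : code m n) : R :=
  n%:R^-1 * \sum_(i < n) \sum_w \sum_s \sum_y \sum_z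
    code_law c w s y z * dist M (s i) (estimator c z i).

Definition num_messages (r : R) (n : nat) : nat :=
  `|Num.ceil (2 `^ (n%:R * r))|%N.

Definition achievable (r D : R) : Prop :=
  exists c : forall n, code (num_messages r n) n,
    (fun n => error_prob (c n)) @ \oo --> (0 : R) /\
    (limn_esup (fun n => (code_distortion (c n))%:E) <= D%:E)%E.

(* A supremum, not a maximum: a memoryless channel need not admit codes with
   exactly ceil (2 ^ (n C)) messages and vanishing error probability.  For
   D >= Dmin the set is nonempty (rate 0) and bounded. *)
Definition capacity_distortion (D : R) : R :=
  sup [set r | 0 <= r /\ achievable r D].

Definition block_law (k : nat) (p : {ffun 'I_k -> X} -> R)
    (x : {ffun 'I_k -> X}) (s : {ffun 'I_k -> S})
    (y : {ffun 'I_k -> Y}) (z : {ffun 'I_k -> Z}) : R :=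
  p x * block_channel x s y z.

(* p(s_i | z^k); equal to 0 when z^k has probability 0. *)
Definition posterior (k : nat) (p : {ffun 'I_k -> X} -> R) (i : 'I_k)
    (z : {ffun 'I_k -> Z}) (a : S) : R :=
  (\sum_x \sum_(s : {ffun 'I_k -> S} | s i == a) \sum_y block_law p x s y z) /
  (\sum_x \sum_s \sum_y block_law p x s y z).

Definition optimal_estimator (k : nat) (p : {ffun 'I_k -> X} -> R)
    (h : {ffun 'I_k -> Z} -> {ffun 'I_k -> Sh}) : Prop :=
  forall (z : {ffun 'I_k -> Z}) (i : 'I_k) (s' : Sh),
    \sum_a posterior p i z a * dist M a (h z i) <=
    \sum_a posterior p i z a * dist M a s'.

Definition block_cond_mutual_info (k : nat) (p : {ffun 'I_k -> X} -> R) : R :=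
  cond_mutual_info (fun (x : {ffun 'I_k -> X}) (y : {ffun 'I_k -> Y})
    (s : {ffun 'I_k -> S}) => \sum_z block_law p x s y z).

Definition block_distortion (k : nat) (p : {ffun 'I_k -> X} -> R)
    (h : {ffun 'I_k -> Z} -> {ffun 'I_k -> Sh}) : R :=
  \sum_x \sum_s \sum_y \sum_z block_law p x s y z * block_dist s (h z).

(* [est k p] is the estimator chosen for block length k and input pmf p. *)
Definition block_capacity
    (est : forall k, ({ffun 'I_k -> X} -> R) ->
                     {ffun 'I_k -> Z} -> {ffun 'I_k -> Sh})
    (D : R) (k : nat) : R :=
  k%:R^-1 * sup [set I | exists p : {ffun 'I_k -> X} -> R,
    [/\ is_pmf p, block_distortion p (est k p) <= k%:R * D
      & I = block_cond_mutual_info p]].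

End BistaticISAC.

(* Main.v *)
Require Import Defs.
From HB Require Import structures.
From mathcomp Require Import all_boot all_order all_algebra.
From mathcomp Require Import all_classical all_reals all_analysis.
From mathcomp Require Import ring lra.
Import Order.TTheory GRing.Theory Num.Theory.
Import numFieldNormedType.Exports.
Local Open Scope classical_set_scope.
Local Open Scope ring_scope.

(** Information is measured in nats.  As the state is independent of the input,
    [I(X^k; Y^k | S^k)] is the mutual information of the channel from [x^k] to
    [(s^k, y^k)].  Let [L] be the supremum over [k] of the normalised block values.

    Sending [m] independent copies of a block input followed by copies of one fixed
    letter [x0] of minimal distortion multiplies the information by [m] and respects
    the constraint; hence the block values converge to [L].

    Achievability: random coding with such a repeated input and a threshold decoder
    on the information density.  By a Chernoff bound the error probability decays
    exponentially, so the codebook average of (large factor) * error + distortion is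
    at most [D + o(1)], and one codebook makes both terms small.

    Converse: by Fano, the uniform input on a code of rate [r] carries information
    about [n r], and has distortion at most [D + (D - e0) / N], [e0] being that of
    [x0].  Repeating it [N] times and adding [n] letters [x0] brings the distortion
    back to [D], so that [r N / (N + 1) <= L]; let [N] tend to infinity. *)

Set Implicit Arguments.
Unset Strict Implicit.
Unset Printing Implicit Defensive.

(** * Elementary bounds on the logarithm and the exponential *)

Lemma ln_le_subr1 (R : realType) (x : R) : 0 < x -> ln x <= x - 1.
Proof.
move=> x0; have -> : x = 1 + (x - 1) by ring.
rewrite (le_trans (le_ln1Dx _)) //; lra.
Qed.

(** From [expR (- x) >= 1 - x] comes [expR x * (1 - x) <= 1], while the quadratic times [1 - x > 0]
    is at least 1 because [2 * x <= 1]. *)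
Lemma expR_le_quadratic (R : realType) (x : R) :
  x <= 2^-1 -> expR x <= 1 + x + 2 * x ^+ 2.
Proof.
move=> hx.
have h1 : 1 - x <= expR (- x) by exact: expR_ge1Dx.
have h2 : expR x * expR (- x) = 1 by rewrite -expRD subrr expR0.
have h3 : 0 < expR x by exact: expR_gt0.
have h4 : expR x * (1 - x) <= 1 by rewrite -[leRHS]h2 ler_pM2l.
have h5 : (1 + x + 2 * x ^+ 2) * (1 - x) = 1 + x ^+ 2 * (1 - 2 * x) by ring.
have h6 : 0 <= x ^+ 2 * (1 - 2 * x).
  by rewrite mulr_ge0 ?sqr_ge0 // subr_ge0 mulrC -ler_pdivlMr // mul1r.
have h7 : 0 < 1 - x.
  by rewrite subr_gt0 (le_lt_trans hx) // invf_lt1 // ltr1n.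
by rewrite -(ler_pM2r h7) h5 (le_trans h4) // lerDl.
Qed.

(** * Means under pmfs and product pmfs *)

Section PmfExpectation.
Variables (R : realType) (T : finType).
Implicit Types (p F : T -> R).

Lemma pmf_mean_le p F (c : R) :
  is_pmf p -> (forall t, c <= F t) -> c <= \sum_t p t * F t.
Proof.
move=> [p0 p1] h; rewrite -[c]mul1r -p1 mulr_suml.
by apply: ler_sum => t _; rewrite ler_wpM2l.
Qed.

(** The probabilistic method: it extracts one codebook from a bound on the average over random
    codebooks. *)
Lemma pmf_exists_le p F (c : R) :
  is_pmf p -> \sum_t p t * F t <= c -> exists t, F t <= c.
Proof.
move=> [p0 p1] h; apply: contrapT => /forallNP hn.
have h0 : forall t, 0 < F t - c.
  by move=> t; rewrite subr_gt0 ltNge; apply/negP/hn.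
have h1 : \sum_t p t * (F t - c) <= 0.
  under eq_bigr do rewrite mulrBr.
  by rewrite sumrB -mulr_suml p1 mul1r subr_le0.
have h2 : forall t, p t = 0.
  move=> t; apply/eqP; rewrite eq_le p0 andbT.
  rewrite -(pmulr_lle0 _ (h0 t)) (le_trans _ h1) //.
  rewrite (bigD1 t) //= lerDl sumr_ge0 // => i _.
  by rewrite mulr_ge0 // ltW.
by move: p1; rewrite big1 // => /eqP; rewrite eq_sym oner_eq0.
Qed.

End PmfExpectation.

Section ProductPmf.
Variables (R : realType) (I A : finType) (p : A -> R).
Hypothesis hp : is_pmf p.

Lemma prod_pmf : is_pmf (fun f : {ffun I -> A} => \prod_i p (f i)).
Proof.
case: hp => p0 p1; split=> [f|]; first by rewrite prodr_ge0.
by rewrite -(bigA_distr_bigA (fun=> p)) big1.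
Qed.

Lemma prod_pmf_mean (i : I) (F : A -> R) :
  \sum_(f : {ffun I -> A}) (\prod_j p (f j)) * F (f i) = \sum_a p a * F a.
Proof.
case: hp => p0 p1.
transitivity (\sum_(f : {ffun I -> A})
  \prod_j (p (f j) * (if j == i then F (f j) else 1))).
  apply: eq_bigr => f _; rewrite big_split /=; congr (_ * _).
  by rewrite -big_mkcond big_pred1_eq.
rewrite -(bigA_distr_bigA (fun j a => p a * (if j == i then F a else 1))).
rewrite (bigD1 i) //= eqxx [X in _ * X]big1 ?mulr1 // => j /negbTE ->.
by under eq_bigr do rewrite mulr1.
Qed.

(** Pairwise independence is enough for random coding, whose union bound compares the sent codeword
    with one rival at a time. *)
Lemma prod_pmf_mean2 (i j : I) (F G : A -> R) : i != j ->
  \sum_(f : {ffun I -> A}) (\prod_k p (f k)) * (F (f i) * G (f j)) =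
  (\sum_a p a * F a) * (\sum_a p a * G a).
Proof.
case: hp => p0 p1 hij.
transitivity (\sum_(f : {ffun I -> A})
  \prod_k (p (f k) * ((if k == i then F (f k) else 1) *
                      (if k == j then G (f k) else 1)))).
  apply: eq_bigr => f _; rewrite !big_split /=; congr (_ * (_ * _)).
    by rewrite -big_mkcond big_pred1_eq.
  by rewrite -big_mkcond big_pred1_eq.
rewrite -(bigA_distr_bigA (fun k a => p a * ((if k == i then F a else 1) *
                      (if k == j then G a else 1)))).
rewrite (bigD1 i) //= (bigD1 j) /=; last by rewrite eq_sym.
rewrite (negbTE hij) eqxx [j == i]eq_sym (negbTE hij) eqxx mulrA.
rewrite [X in _ * X]big1 ?mulr1.
  congr (_ * _); apply: eq_bigr => a _; first by rewrite mulr1.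
  by rewrite mul1r.
move=> k /andP[/negbTE -> /negbTE ->].
by under eq_bigr do rewrite !mulr1.
Qed.

End ProductPmf.

(** * Information density of a channel under an input pmf *)

Section Channel.
Variables (R : realType) (A B : finType) (W : A -> B -> R) (p : A -> R).
Hypothesis hW : forall a, is_pmf (W a).
Hypothesis hp : is_pmf p.

Definition output_pmf b := \sum_a p a * W a b.

Definition density a b := W a b / output_pmf b.

(** Generic in [phi], so that mutual information and moment generating function share one reindexing
    for product channels. *)
Definition density_mean (phi : R -> R) :=
  \sum_a \sum_b p a * W a b * phi (density a b).

Definition mutual_info := density_mean (@ln R).

Definition density_mgf (t : R) := density_mean (fun u => expR (- (t * ln u))).

Let p_ge0 a : 0 <= p a. Proof. exact: hp.1. Qed.
Let W_ge0 a b : 0 <= W a b. Proof. exact: (hW a).1. Qed.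
Let pW_ge0 a b : 0 <= p a * W a b. Proof. exact: mulr_ge0. Qed.

Lemma joint_le_output a b : p a * W a b <= output_pmf b.
Proof. by rewrite /output_pmf (bigD1 a) //= lerDl sumr_ge0. Qed.

Lemma output_pmf_ge0 b : 0 <= output_pmf b.
Proof. exact: sumr_ge0. Qed.

Lemma sum_joint : \sum_a \sum_b p a * W a b = 1.
Proof.
under eq_bigr do rewrite -mulr_sumr (hW _).2 mulr1.
exact: hp.2.
Qed.

Lemma sum_output_pmf : \sum_b output_pmf b = 1.
Proof. by rewrite exchange_big sum_joint. Qed.

Lemma joint_gt0 a b : p a * W a b != 0 ->
  [/\ 0 < p a, 0 < W a b & 0 < output_pmf b].
Proof.
move=> h; have h0 : 0 < p a * W a b by rewrite lt_neqAle eq_sym h pW_ge0.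
move: (h); rewrite mulf_eq0 negb_or => /andP[h1 h2].
split; [by rewrite lt_neqAle eq_sym h1 p_ge0
  |by rewrite lt_neqAle eq_sym h2 W_ge0|].
exact: lt_le_trans h0 (joint_le_output a b).
Qed.

Lemma density_gt0 a b : p a * W a b != 0 -> 0 < density a b.
Proof. by move=> /joint_gt0[_ h1 h2]; rewrite divr_gt0. Qed.

(* [ln (W / (q N)) <= W / (q N) - 1], and [p W <= q]. *)
Lemma mutual_info_le_ln_card : (0 < #|A|)%N -> mutual_info <= ln #|A|%:R.
Proof.
move=> hA; have N0 : (0 : R) < #|A|%:R by rewrite ltr0n.
rewrite -subr_le0 -[ln #|A|%:R]mul1r -[X in _ - X * _]sum_joint mulr_suml.
rewrite /mutual_info /density_mean -sumrB.
under eq_bigr do rewrite mulr_suml -sumrB.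
apply: (@le_trans _ _ (\sum_a \sum_b (W a b / #|A|%:R - p a * W a b))).
  apply: ler_sum => a _; apply: ler_sum => b _.
  have [h0|h0] := eqVneq (p a * W a b) 0.
    by rewrite h0 !mul0r subrr subr0 divr_ge0 // ltW.
  have [h1 h2 h3] := joint_gt0 h0; have h4 := density_gt0 h0.
  rewrite -mulrBr -ln_div ?posrE //.
  apply: (@le_trans _ _ (p a * W a b * (density a b / #|A|%:R - 1))).
    by rewrite ler_wpM2l ?pW_ge0 // ln_le_subr1 // divr_gt0.
  rewrite mulrBr mulr1 lerD2r mulrA ler_pM2r ?invr_gt0 // /density.
  rewrite mulrCA ler_piMr // ler_pdivrMr // mul1r; exact: joint_le_output.
under eq_bigr do rewrite sumrB -mulr_suml (hW _).2 mul1r.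
rewrite sumrB sum_joint sumr_const -[_ *+ _]mulr_natr mulVf ?subrr //.
by rewrite gt_eqF.
Qed.

(** Where the density is at most [expR c], the indicator 1 is at most [expR (t * c)] times the
    density to the power [- t]. *)
Lemma chernoff_density (t c : R) : 0 <= t ->
  \sum_a \sum_b p a * W a b * (W a b <= expR c * output_pmf b)%R%:R <=
  expR (t * c) * density_mgf t.
Proof.
move=> t0; rewrite mulr_sumr; apply: ler_sum => a _.
rewrite mulr_sumr; apply: ler_sum => b _.
have [h0|h0] := eqVneq (p a * W a b) 0; first by rewrite h0 !mul0r mulr0.
have [h1 h2 h3] := joint_gt0 h0; have h4 := density_gt0 h0.
rewrite mulrCA ler_wpM2l ?pW_ge0 // -expRD.
have [h|_] := boolP (W a b <= _); last exact: expR_ge0.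
have h5 : ln (density a b) <= c.
  by rewrite -ler_expR lnK ?posrE // ler_pdivrMr.
by rewrite -(@expR0 R) ler_expR -mulrBr mulr_ge0 // subr_ge0.
Qed.

(** Second-order expansion at [t = 0], where the slope is [- mutual_info]: below the mutual
    information, a small [t] yields a positive error exponent. *)
Lemma density_mgf_small : exists K : R, exists2 t0 : R, 0 < t0 &
  0 <= K /\ forall t, 0 <= t <= t0 ->
  density_mgf t <= expR (- (t * mutual_info) + t ^+ 2 * K).
Proof.
(* The alphabets are finite, so one [L] bounds every log-density; [t <= t0] then gives
   [t * L <= 1/2], the range of the quadratic bound. *)
pose L := \sum_a \sum_b `|ln (density a b)|.
have L0 : 0 <= L by apply: sumr_ge0 => a _; apply: sumr_ge0.
have hL a b : `|ln (density a b)| <= L.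
  rewrite /L (bigD1 a) //= (bigD1 b) //= -addrA lerDl addr_ge0 //.
    exact: sumr_ge0.
  by apply: sumr_ge0 => ? _; apply: sumr_ge0.
pose K := \sum_a \sum_b p a * W a b * (2 * ln (density a b) ^+ 2).
exists K; exists (2 * (L + 1))^-1; first by rewrite invr_gt0; lra.
split.
  apply: sumr_ge0 => a _; apply: sumr_ge0 => b _.
  by rewrite mulr_ge0 ?pW_ge0 // mulr_ge0 // sqr_ge0.
move=> t /andP[t0 ht].
apply: (@le_trans _ _ (1 + (- (t * mutual_info) + t ^+ 2 * K))); last first.
  exact: expR_ge1Dx.
rewrite -{1}sum_joint /mutual_info /density_mgf /density_mean /K.
rewrite !mulr_sumr -sumrN -!big_split /=; apply: ler_sum => a _.
rewrite !mulr_sumr -sumrN -!big_split /=; apply: ler_sum => b _.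
have -> : p a * W a b + (- (t * (p a * W a b * ln (density a b))) +
   t ^+ 2 * (p a * W a b * (2 * ln (density a b) ^+ 2))) =
   p a * W a b * (1 + (- (t * ln (density a b))) +
     2 * (- (t * ln (density a b))) ^+ 2) by ring.
rewrite ler_wpM2l ?pW_ge0 // expR_le_quadratic //.
apply: le_trans (ler_norm _) _; rewrite normrN normrM ger0_norm //.
apply: (@le_trans _ _ ((2 * (L + 1))^-1 * (L + 1))).
  by apply: ler_pM => //; rewrite (le_trans (hL _ _)) // lerDl.
rewrite invfM -mulrA mulVf ?mulr1 //; lra.
Qed.

End Channel.

(** * Fano's inequality and random coding over an abstract channel *)

Section Coding.
Variables (R : realType) (A B : finType) (W : A -> B -> R).
Hypothesis hW : forall a, is_pmf (W a).

Let W_ge0 a b : 0 <= W a b. Proof. exact: (hW a).1. Qed.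

Definition channel_error (m : nat) (enc : 'I_m -> A) (dec : B -> 'I_m) : R :=
  \sum_w \sum_b m%:R^-1 * W (enc w) b * (dec b != w)%:R.

(** The input law induced by a uniform message; a codeword shared by several messages is weighted by
    their number. *)
Definition codebook_pmf (m : nat) (enc : 'I_m -> A) (a : A) : R :=
  \sum_w m%:R^-1 * (enc w == a)%:R.

Lemma codebook_mean (m : nat) (enc : 'I_m -> A) (F : A -> R) :
  \sum_a codebook_pmf enc a * F a = \sum_w m%:R^-1 * F (enc w).
Proof.
under eq_bigr do rewrite mulr_suml.
rewrite exchange_big; apply: eq_bigr => w _.
rewrite (bigD1 (enc w)) //= eqxx mulr1 big1 ?addr0 // => a.
by rewrite eq_sym => /negbTE ->; rewrite mulr0 mul0r.
Qed.

Lemma uniform_sum1 (m : nat) : (0 < m)%N ->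
  \sum_(w < m) (m%:R^-1 : R) = 1.
Proof.
move=> m0; rewrite sumr_const card_ord -[_ *+ _]mulr_natr mulVf //.
by rewrite pnatr_eq0 -lt0n.
Qed.

Lemma codebook_is_pmf (m : nat) (enc : 'I_m -> A) :
  (0 < m)%N -> is_pmf (codebook_pmf enc).
Proof.
move=> m0; split=> [a|]; first by apply: sumr_ge0 => w _; rewrite mulr_ge0.
transitivity (\sum_a codebook_pmf enc a * 1).
  by apply: eq_bigr => a _; rewrite mulr1.
rewrite codebook_mean; under eq_bigr do rewrite mulr1.
exact: uniform_sum1.
Qed.

(* Under the joint law [P] of message and output, and the product [Q] of its
   marginals, [sum P ln (P / Q) >= sum P ln g - ln (sum Q g)]; here [g = m] where
   the decoder is right and [g = 1] elsewhere, so that [sum Q g <= 2]. *)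
Lemma fano (m : nat) (enc : 'I_m -> A) (dec : B -> 'I_m) : (0 < m)%N ->
  (1 - channel_error enc dec) * ln m%:R <=
  mutual_info W (codebook_pmf enc) + ln 2.
Proof.
move=> m0; set p := codebook_pmf enc.
have hp : is_pmf p by exact: codebook_is_pmf.
have M0 : (0 : R) < m%:R by rewrite ltr0n.
have sum1 : \sum_w \sum_b m%:R^-1 * W (enc w) b = 1.
  under eq_bigr do rewrite -mulr_sumr (hW _).2 mulr1.
  exact: uniform_sum1.
rewrite -subr_le0 opprD -[ln 2]mul1r -{1}sum1 -[X in _ - X * ln 2]sum1.
have -> : mutual_info W p =
    \sum_w \sum_b m%:R^-1 * W (enc w) b * ln (density W p (enc w) b).
  rewrite /mutual_info /density_mean.
  under eq_bigr do under eq_bigr do rewrite -mulrA.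
  under eq_bigr do rewrite -mulr_sumr.
  rewrite codebook_mean; apply: eq_bigr => w _.
  by rewrite mulr_sumr; apply: eq_bigr => b _; rewrite mulrA.
rewrite /channel_error -sumrB mulr_suml mulr_suml addrA -!sumrB.
set q := output_pmf W p.
(* [ln u <= u - 1] is used at [u = g / (2 * density)]. As [m^-1 * g <= m^-1 + (dec b == w)], whose
   sum over [w] is 2, the factor 2 brings the total down to the mass 1 that is subtracted. *)
apply: (@le_trans _ _ (\sum_w \sum_b
  (q b * 2^-1 * (m%:R^-1 + (dec b == w)%:R) - m%:R^-1 * W (enc w) b))).
  apply: ler_sum => w _.
  rewrite -sumrB !mulr_suml -!sumrB; apply: ler_sum => b _.
  have [h0|h0] := eqVneq (W (enc w) b) 0.
    rewrite h0 !(mulr0, mul0r, subrr, subr0).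
    apply: mulr_ge0; last by rewrite addr_ge0 // invr_ge0 ltW.
    by rewrite mulr_ge0 ?invr_ge0 // (output_pmf_ge0 hW hp).
  have hpw : m%:R^-1 <= p (enc w).
    rewrite /p /codebook_pmf (bigD1 w) //= eqxx mulr1 lerDl.
    by apply: sumr_ge0 => *; rewrite mulr_ge0.
  have hj : p (enc w) * W (enc w) b != 0.
    rewrite mulf_neq0 // gt_eqF // (lt_le_trans _ hpw) // invr_gt0 //.
  have [h1 h2 h3] := joint_gt0 hW hp hj; have h4 := density_gt0 hW hp hj.
  have h5 : 0 < density W p (enc w) b * 2 by exact: mulr_gt0.
  pose g : R := if dec b == w then m%:R else 1.
  have g0 : 0 < g by rewrite /g; case: ifP.
  apply: (@le_trans _ _ (m%:R^-1 * W (enc w) b *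
      (g / (density W p (enc w) b * 2) - 1))).
    apply: (@le_trans _ _ (m%:R^-1 * W (enc w) b *
      ln (g / (density W p (enc w) b * 2)))); last first.
      by rewrite ler_wpM2l ?mulr_ge0 // ln_le_subr1 // divr_gt0.
    rewrite [ln (g / _)]ln_div ?posrE // [ln (_ * 2)]lnM ?posrE //.
    have -> : ln g = (1 - (dec b != w)%:R) * ln m%:R.
      by rewrite /g; case: eqP => _; rewrite ?subr0 ?mul1r ?subrr ?mul0r ?ln1.
    rewrite le_eqVlt; apply/orP; left; apply/eqP; ring.
  rewrite mulrBr mulr1 lerD2r.
  have -> : m%:R^-1 * W (enc w) b * (g / (density W p (enc w) b * 2)) =
      q b * 2^-1 * (m%:R^-1 * g).
    rewrite /density -/q; field.
    by rewrite gt_eqF // gt_eqF // gt_eqF.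
  rewrite ler_wpM2l ?mulr_ge0 ?invr_ge0 ?(ltW h3) // /g; case: eqP => _.
    by rewrite mulVf ?gt_eqF // lerDr invr_ge0.
  by rewrite mulr1 addr0.
under eq_bigr do rewrite sumrB.
rewrite sumrB sum1 exchange_big /=.
under eq_bigr do rewrite -mulr_sumr big_split /= uniform_sum1 //.
suff -> : \sum_b q b * 2^-1 * (1 + \sum_(w < m) (dec b == w)%:R) = 1.
  by rewrite subrr.
rewrite -[RHS](sum_output_pmf hW hp); apply: eq_bigr => b _.
rewrite (bigD1 (dec b)) //= eqxx big1 ?addr0 -?mulrA ?mulVf ?mulr1 //.
by move=> w; rewrite eq_sym => /negbTE ->.
Qed.

(* Independent codewords drawn from [p], and the decoder that picks a message
   whose density with the output exceeds the threshold [expR c]. *)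
Lemma random_coding (p delta : A -> R) (m : nat) (c lam : R) :
  is_pmf p -> (0 < m)%N -> 0 <= lam ->
  exists (enc : 'I_m -> A) (dec : B -> 'I_m),
    lam * channel_error enc dec + m%:R^-1 * \sum_w delta (enc w) <=
    lam * (\sum_a \sum_b p a * W a b *
             (W a b <= expR c * output_pmf W p b)%R%:R + m%:R * expR (- c)) +
    \sum_a p a * delta a.
Proof.
move=> hp m0 lam0; have M0 : (0 : R) < m%:R by rewrite ltr0n.
set q := output_pmf W p; set P1 := \sum_a \sum_b _.
have q0 b : 0 <= q b by exact: (output_pmf_ge0 hW hp).
pose w0 := Ordinal m0.
pose dec (f : {ffun 'I_m -> A}) b : 'I_m :=
  odflt w0 [pick w | expR c * q b < W (f w) b].
pose low a b : R := (W a b <= expR c * q b)%R%:R.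
pose high a b : R := (expR c * q b < W a b)%R%:R.
(* Union bound: if [w] passes the threshold but is not chosen, [pick] has found another message that
   passes it. *)
have decE f b w : ((dec f b != w)%:R : R) <=
    low (f w) b + \sum_(w' | w' != w) high (f w') b.
  have s0 : 0 <= \sum_(w' | w' != w) high (f w') b by exact: sumr_ge0.
  rewrite /low; case: (boolP (W (f w) b <= expR c * q b)%R) => [_|hw].
    by rewrite (@le_trans _ _ 1) ?lerDl // lern1 leq_b1.
  rewrite add0r; rewrite -ltNge in hw.
  have [_|hd] := eqVneq (dec f b) w; first exact: s0.
  rewrite (bigD1 (dec f b)) //= /high.
  have -> : expR c * q b < W (f (dec f b)) b.
    by rewrite /dec; case: pickP => [//|/(_ w)]; rewrite hw.
  by rewrite lerDl sumr_ge0.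
have [P0 P_1] := @prod_pmf R 'I_m A p hp.
pose Pf (f : {ffun 'I_m -> A}) := \prod_w p (f w).
have mean_err : \sum_f Pf f * channel_error f (dec f) <= P1 + m%:R * expR (- c).
  apply: (@le_trans _ _ (\sum_(w < m) \sum_b m%:R^-1 *
    (\sum_f Pf f * (W (f w) b * low (f w) b) +
     \sum_(w' < m | w' != w) \sum_f Pf f * (W (f w) b * high (f w') b)))).
    rewrite /channel_error.
    under eq_bigr do rewrite mulr_sumr.
    rewrite exchange_big; apply: ler_sum => w _.
    under eq_bigr do rewrite mulr_sumr.
    rewrite exchange_big; apply: ler_sum => b _.
    rewrite exchange_big -big_split mulr_sumr /=; apply: ler_sum => f _.
    rewrite -mulr_sumr -mulrDr -mulr_sumr -mulrDr.
    rewrite -[_ * _ * (_ != _)%:R]mulrA mulrCA ler_wpM2l ?invr_ge0 //.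
    by rewrite ler_wpM2l ?P0 // ler_wpM2l.
  apply: (@le_trans _ _ (\sum_(w < m) \sum_b m%:R^-1 *
    ((\sum_a p a * (W a b * low a b)) + m%:R * (q b * expR (- c))))).
    apply: ler_sum => w _; apply: ler_sum => b _.
    rewrite ler_wpM2l ?invr_ge0 // /Pf.
    rewrite (prod_pmf_mean hp w (fun a => W a b * low a b)) lerD2l.
    apply: (@le_trans _ _ (\sum_(w' < m | w' != w) q b * expR (- c))).
      apply: ler_sum => w' hw'.
      (* Codeword [w'] is independent of the output caused by [w]; above the threshold
         [q b <= expR (- c) * W a b], so the average over [a] gains a factor [expR (- c)]. *)
      rewrite (prod_pmf_mean2 hp (fun a => W a b) (high ^~ b)) 1?eq_sym //.
      rewrite -/(output_pmf W p b) -/q mulr_sumr /q {2}/output_pmf mulr_suml.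
      apply: ler_sum => a _; rewrite -/q mulrCA -mulrA ler_wpM2l ?(hp.1) //.
      rewrite /high; case: (boolP (expR c * q b < W a b)%R) => [h|_].
        by rewrite mulr1 expRN ler_pdivlMr ?expR_gt0 // mulrC ltW.
      by rewrite mulr0 mulr_ge0 // expR_ge0.
    rewrite sumr_const -[_ *+ _]mulr_natl ler_wpM2r ?mulr_ge0 ?expR_ge0 //.
    by rewrite ler_nat (leq_trans (max_card _)) // card_ord.
  under eq_bigr do rewrite -mulr_sumr.
  rewrite -mulr_suml uniform_sum1 // mul1r big_split /=.
  rewrite -mulr_sumr -mulr_suml (sum_output_pmf hW hp) mul1r lerD2r.
  rewrite exchange_big /P1.
  by under eq_bigr do under eq_bigr do rewrite mulrA.
have mean_delta : \sum_f Pf f * (m%:R^-1 * \sum_w delta (f w)) =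
    \sum_a p a * delta a.
  under eq_bigr do rewrite mulrCA mulr_sumr.
  rewrite -mulr_sumr exchange_big /=.
  under eq_bigr do rewrite prod_pmf_mean //.
  by rewrite mulr_sumr -mulr_suml uniform_sum1 // mul1r.
have [f hf] : exists f : {ffun 'I_m -> A},
    lam * channel_error f (dec f) + m%:R^-1 * \sum_w delta (f w) <=
    lam * (P1 + m%:R * expR (- c)) + \sum_a p a * delta a.
  apply: (pmf_exists_le (@prod_pmf R 'I_m A p hp)).
  under eq_bigr do rewrite mulrDr.
  rewrite big_split /= mean_delta lerD2r.
  under eq_bigr do rewrite mulrCA.
  by rewrite -mulr_sumr ler_wpM2l.
by exists f, (dec f).
Qed.

End Coding.

Lemma sum_pair (R : realType) (A B : finType) (F : A * B -> R) :
  \sum_u F u = \sum_a \sum_b F (a, b).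
Proof. by rewrite pair_bigA; apply: eq_bigr => -[]. Qed.

(** * Independent use of two channels *)

Section ProductChannel.
Variables (R : realType) (A1 A2 A B1 B2 B : finType).
Variables (W1 : A1 -> B1 -> R) (W2 : A2 -> B2 -> R) (W : A -> B -> R).
Variables (p1 : A1 -> R) (p2 : A2 -> R) (p : A -> R).
Variables (eA : A1 * A2 -> A) (eB : B1 * B2 -> B).
Hypotheses (eA_bij : bijective eA) (eB_bij : bijective eB).
Hypotheses (hW1 : forall a, is_pmf (W1 a)) (hW2 : forall a, is_pmf (W2 a)).
Hypotheses (hp1 : is_pmf p1) (hp2 : is_pmf p2).
Hypothesis WE : forall a1 a2 b1 b2,
  W (eA (a1, a2)) (eB (b1, b2)) = W1 a1 b1 * W2 a2 b2.
Hypothesis pE : forall a1 a2, p (eA (a1, a2)) = p1 a1 * p2 a2.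

Lemma sum_pair_bij (F : A -> R) (F1 : A1 -> R) (F2 : A2 -> R) :
  (forall a1 a2, F (eA (a1, a2)) = F1 a1 * F2 a2) ->
  \sum_a F a = (\sum_a F1 a) * (\sum_a F2 a).
Proof.
move=> FE; rewrite (reindex eA) /=; last exact: onW_bij.
rewrite big_distrlr /= sum_pair; apply: eq_bigr => a1 _.
by apply: eq_bigr => a2 _; exact: FE.
Qed.

Lemma output_pmf_product b1 b2 :
  output_pmf W p (eB (b1, b2)) = output_pmf W1 p1 b1 * output_pmf W2 p2 b2.
Proof. by apply: sum_pair_bij => a1 a2; rewrite WE pE mulrACA. Qed.

(** The output pmf factorises, hence so does the density. [A] and [B] are only in bijection with
    products because blocks are joined by concatenation. *)
Lemma density_mean_reindex (phi : R -> R) :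
  density_mean W p phi = \sum_a1 \sum_b1 \sum_a2 \sum_b2
    (p1 a1 * W1 a1 b1) * (p2 a2 * W2 a2 b2) *
    phi (density W1 p1 a1 b1 * density W2 p2 a2 b2).
Proof.
rewrite /density_mean (reindex eA) /=; last exact: onW_bij.
under eq_bigr do rewrite (reindex eB (onW_bij _ eB_bij)) /=.
rewrite sum_pair; apply: eq_bigr => a1 _; rewrite exchange_big /=.
rewrite sum_pair; apply: eq_bigr => b1 _; rewrite exchange_big /=.
apply: eq_bigr => a2 _; apply: eq_bigr => b2 _.
by rewrite /density WE pE output_pmf_product (mulrACA (p1 _)) invfM (mulrACA (W1 _ _)).
Qed.

(** The logarithm splits where both joint weights are nonzero, and other terms vanish; each half
    meets the total mass 1 of the other channel. *)
Lemma mutual_info_product :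
  mutual_info W p = mutual_info W1 p1 + mutual_info W2 p2.
Proof.
rewrite /mutual_info density_mean_reindex.
transitivity (\sum_a1 \sum_b1 \sum_a2 \sum_b2
  ((p1 a1 * W1 a1 b1 * ln (density W1 p1 a1 b1)) * (p2 a2 * W2 a2 b2) +
   (p1 a1 * W1 a1 b1) * (p2 a2 * W2 a2 b2 * ln (density W2 p2 a2 b2)))).
  apply: eq_bigr => a1 _; apply: eq_bigr => b1 _.
  apply: eq_bigr => a2 _; apply: eq_bigr => b2 _.
  have [h1|h1] := eqVneq (p1 a1 * W1 a1 b1) 0; first by rewrite h1 !mul0r addr0.
  have [h2|h2] := eqVneq (p2 a2 * W2 a2 b2) 0.
    by rewrite h2 !(mul0r, mulr0) addr0.
  rewrite lnM ?posrE; first ring.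
    exact: (density_gt0 hW1 hp1 h1).
  exact: (density_gt0 hW2 hp2 h2).
rewrite /density_mean -[X in X + _]mulr1 -[X in _ + X]mul1r.
rewrite -{1}(sum_joint hW2 hp2) -(sum_joint hW1 hp1) !mulr_suml -big_split /=.
apply: eq_bigr => a1 _; rewrite !mulr_suml -big_split; apply: eq_bigr => b1 _.
rewrite !mulr_sumr -big_split; apply: eq_bigr => a2 _.
by rewrite !mulr_sumr -big_split.
Qed.

Lemma density_mgf_product (t : R) :
  density_mgf W p t = density_mgf W1 p1 t * density_mgf W2 p2 t.
Proof.
rewrite /density_mgf density_mean_reindex /density_mean mulr_suml.
apply: eq_bigr => a1 _; rewrite mulr_suml; apply: eq_bigr => b1 _.
rewrite mulr_sumr; apply: eq_bigr => a2 _; rewrite mulr_sumr; apply: eq_bigr => b2 _.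
have [h1|h1] := eqVneq (p1 a1 * W1 a1 b1) 0; first by rewrite h1 !mul0r.
have [h2|h2] := eqVneq (p2 a2 * W2 a2 b2) 0.
  by rewrite h2 !(mul0r, mulr0).
rewrite [RHS]mulrACA -expRD lnM ?posrE; last 2 first.
- exact: (density_gt0 hW1 hp1 h1).
- exact: (density_gt0 hW2 hp2 h2).
by rewrite mulrDr opprD.
Qed.

End ProductChannel.

(** * Deterministic inputs *)

Section PointMass.
Variables (R : realType) (A B : finType) (W : A -> B -> R) (a0 : A).
Hypothesis hW : forall a, is_pmf (W a).

Definition point_mass (a : A) : R := (a == a0)%:R.

Lemma point_mass_mean (F : A -> R) : \sum_a point_mass a * F a = F a0.
Proof.
rewrite (bigD1 a0) //= /point_mass eqxx mul1r big1 ?addr0 // => a /negbTE ->.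
by rewrite mul0r.
Qed.

Lemma point_mass_is_pmf : is_pmf point_mass.
Proof.
split=> [a|]; first exact: ler0n.
by rewrite -(point_mass_mean (fun=> 1)); apply: eq_bigr => a _; rewrite mulr1.
Qed.

(** The output pmf is the row of [a0], so the density is 1 wherever the weight is nonzero: padding
    letters carry no information. *)
Lemma density_mean_point_mass (phi : R -> R) :
  density_mean W point_mass phi = phi 1.
Proof.
rewrite /density_mean.
under eq_bigr do under eq_bigr do rewrite -mulrA.
under eq_bigr do rewrite -mulr_sumr.
rewrite point_mass_mean -[RHS]mul1r -[X in _ = X * _](hW a0).2 mulr_suml.
apply: eq_bigr => b _; rewrite /density /output_pmf point_mass_mean.
have [->|h] := eqVneq (W a0 b) 0; first by rewrite !mul0r.
by rewrite divff.
Qed.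

Lemma mutual_info_point_mass : mutual_info W point_mass = 0.
Proof. by rewrite /mutual_info density_mean_point_mass ln1. Qed.

Lemma density_mgf_point_mass t : density_mgf W point_mass t = 1.
Proof. by rewrite /density_mgf density_mean_point_mass ln1 mulr0 oppr0 expR0. Qed.

End PointMass.

(** * Concatenation of blocks *)

Section Concatenation.
Variables (k l : nat) (T : Type).

Definition ffun_cat (f : {ffun 'I_k -> T}) (g : {ffun 'I_l -> T}) :
    {ffun 'I_(k + l) -> T} :=
  [ffun i => match fintype.split i with inl j => f j | inr j => g j end].

Definition ffun_left (f : {ffun 'I_(k + l) -> T}) : {ffun 'I_k -> T} :=
  [ffun i => f (lshift l i)].

Definition ffun_right (f : {ffun 'I_(k + l) -> T}) : {ffun 'I_l -> T} :=
  [ffun i => f (rshift k i)].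

Lemma ffun_cat_lshift f g i : ffun_cat f g (lshift l i) = f i.
Proof. by rewrite ffunE (unsplitK (inl i)). Qed.

Lemma ffun_cat_rshift f g i : ffun_cat f g (rshift k i) = g i.
Proof. by rewrite ffunE (unsplitK (inr i)). Qed.

Lemma ffun_catK f : ffun_cat (ffun_left f) (ffun_right f) = f.
Proof.
apply/ffunP => i; rewrite ffunE; case: fintype.splitP => j ij; rewrite ffunE.
  by congr (f _); apply: val_inj.
by congr (f _); apply: val_inj.
Qed.

Lemma ffun_left_cat f g : ffun_left (ffun_cat f g) = f.
Proof. by apply/ffunP => i; rewrite ffunE ffun_cat_lshift. Qed.

Lemma ffun_right_cat f g : ffun_right (ffun_cat f g) = g.
Proof. by apply/ffunP => i; rewrite ffunE ffun_cat_rshift. Qed.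

Lemma ffun_cat_bij : bijective (fun fg => ffun_cat fg.1 fg.2).
Proof.
exists (fun f => (ffun_left f, ffun_right f)) => [[f g]|f] /=.
  by rewrite ffun_left_cat ffun_right_cat.
exact: ffun_catK.
Qed.

End Concatenation.

Lemma sum3_prod (R : realType) (S Y Z : finType) (n : nat)
    (F : 'I_n -> S -> Y -> Z -> R) :
  \sum_(s : {ffun 'I_n -> S}) \sum_(y : {ffun 'I_n -> Y})
    \sum_(z : {ffun 'I_n -> Z}) \prod_i F i (s i) (y i) (z i) =
  \prod_i \sum_a \sum_b \sum_c F i a b c.
Proof.
rewrite bigA_distr_bigA; apply: eq_bigr => s _.
rewrite bigA_distr_bigA; apply: eq_bigr => y _.
by rewrite bigA_distr_bigA.
Qed.

(** * Block channels, their information and their distortion *)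

Section BlockChannel.
Variables (R : realType) (X S Y Z Sh : finType).
Variable M : bistatic_isac R X S Y Z Sh.

Definition receiver_channel (k : nat) (x : {ffun 'I_k -> X})
    (b : {ffun 'I_k -> S} * {ffun 'I_k -> Y}) : R :=
  \sum_z block_channel M x b.1 b.2 z.

(** Conditioning on the input block makes the distortion constraint linear in the input pmf. *)
Definition input_distortion (k : nat)
    (h : {ffun 'I_k -> Z} -> {ffun 'I_k -> Sh}) (x : {ffun 'I_k -> X}) : R :=
  \sum_s \sum_y \sum_z block_channel M x s y z * block_dist M s (h z).

Definition letter_distortion (x : X) (g : Z -> Sh) : R :=
  \sum_s \sum_y \sum_z
    state_pmf M s * channel M x s (y, z) * dist M s (g z).

Let state_ge0 s : 0 <= state_pmf M s. Proof. exact: (state_pmfP M).1. Qed.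
Let channel_ge0 x s b : 0 <= channel M x s b.
Proof. exact: (channelP M x s).1. Qed.

Lemma block_channel_ge0 k (x : {ffun 'I_k -> X}) s y z :
  0 <= block_channel M x s y z.
Proof. by apply: prodr_ge0 => i _; exact: mulr_ge0. Qed.

Lemma input_distortion_ge0 k h (x : {ffun 'I_k -> X}) :
  0 <= input_distortion h x.
Proof.
do 3![apply: sumr_ge0 => ? _]; rewrite mulr_ge0 ?block_channel_ge0 //.
by apply: sumr_ge0 => i _; exact: dist_ge0.
Qed.

Lemma sum_letter_channel x s : \sum_y \sum_z channel M x s (y, z) = 1.
Proof. by rewrite -sum_pair; exact: (channelP M x s).2. Qed.

Lemma sum_receiver_channel_output k (x : {ffun 'I_k -> X}) s :
  \sum_y receiver_channel x (s, y) = \prod_i state_pmf M (s i).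
Proof.
transitivity (\sum_(y : {ffun 'I_k -> Y})
    \prod_i \sum_c state_pmf M (s i) * channel M (x i) (s i) (y i, c)).
  by apply: eq_bigr => y _; rewrite bigA_distr_bigA.
rewrite -(bigA_distr_bigA
  (fun i b => \sum_c state_pmf M (s i) * channel M (x i) (s i) (b, c))).
apply: eq_bigr => i _; under eq_bigr do rewrite -mulr_sumr.
by rewrite -mulr_sumr sum_letter_channel mulr1.
Qed.

Lemma receiver_channel_is_pmf k (x : {ffun 'I_k -> X}) :
  is_pmf (receiver_channel x).
Proof.
split=> [b|]; first by apply: sumr_ge0 => z _; exact: block_channel_ge0.
rewrite sum_pair; under eq_bigr do rewrite sum_receiver_channel_output.
exact: (prod_pmf _ (state_pmfP M)).2.
Qed.

Lemma sum_block_channel k (x : {ffun 'I_k -> X}) :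
  \sum_s \sum_y \sum_z block_channel M x s y z = 1.
Proof. by rewrite -(receiver_channel_is_pmf x).2 sum_pair. Qed.

(** By independence [P(x,s) = p(x) P(s)], so the state factors cancel in the ratio and leave the
    density; [ln 2] converts nats to bits. *)
Lemma block_cond_mutual_infoE k (p : {ffun 'I_k -> X} -> R) : is_pmf p ->
  block_cond_mutual_info M p = mutual_info (@receiver_channel k) p / ln 2.
Proof.
move=> hp; rewrite /block_cond_mutual_info /cond_mutual_info.
have lawE x y s : \sum_z block_law M p x s y z = p x * receiver_channel x (s, y).
  by rewrite mulr_sumr.
rewrite /mutual_info /density_mean mulr_suml; apply: eq_bigr => x _.
rewrite sum_pair exchange_big mulr_suml; apply: eq_bigr => s _.
rewrite mulr_suml; apply: eq_bigr => y _ /=.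
rewrite lawE /log2 mulrA.
have [->|h] := eqVneq (p x * receiver_channel x (s, y)) 0.
  by rewrite !mul0r.
congr (_ * ln _ / _).
have [h1 h2 h3] := joint_gt0 (@receiver_channel_is_pmf k) hp h.
have h4 : 0 < \prod_i state_pmf M (s i).
  rewrite -(sum_receiver_channel_output x) (bigD1 y) //=.
  rewrite ltr_pwDl // sumr_ge0 // => y' _.
  exact: (receiver_channel_is_pmf x).1.
have -> : \sum_a \sum_b \sum_z block_law M p a s b z = \prod_i state_pmf M (s i).
  rewrite -[RHS]mul1r -[X in _ = X * _]hp.2 mulr_suml; apply: eq_bigr => a _.
  rewrite -(sum_receiver_channel_output a) mulr_sumr; apply: eq_bigr => b _.
  exact: lawE.
have -> : \sum_b \sum_z block_law M p x s b z = p x * \prod_i state_pmf M (s i).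
  rewrite -(sum_receiver_channel_output x) mulr_sumr; apply: eq_bigr => b _.
  exact: lawE.
have -> : \sum_a \sum_z block_law M p a s y z =
    output_pmf (@receiver_channel k) p (s, y).
  by apply: eq_bigr => a _; rewrite lawE.
rewrite /density; field.
by rewrite !gt_eqF.
Qed.

Lemma block_distortionE k (p : {ffun 'I_k -> X} -> R) h :
  block_distortion M p h = \sum_x p x * input_distortion h x.
Proof.
apply: eq_bigr => x _; rewrite mulr_sumr; apply: eq_bigr => s _.
rewrite mulr_sumr; apply: eq_bigr => y _.
by rewrite mulr_sumr; apply: eq_bigr => z _; rewrite mulrA.
Qed.

(** The distortion is a sum over [z] and [i] of the mass of [z] times a posterior risk, and [h]
    minimises each risk separately. *)
Lemma optimal_estimator_le k (p : {ffun 'I_k -> X} -> R) h h' :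
  is_pmf p -> optimal_estimator M p h ->
  block_distortion M p h <= block_distortion M p h'.
Proof.
move=> hp hopt.
pose mass (z : {ffun 'I_k -> Z}) := \sum_x \sum_s \sum_y block_law M p x s y z.
pose num z (i : 'I_k) a :=
  \sum_x \sum_(s : {ffun 'I_k -> S} | s i == a) \sum_y block_law M p x s y z.
have law0 x s y z : 0 <= block_law M p x s y z.
  by rewrite mulr_ge0 ?block_channel_ge0 // hp.1.
have mass0 z : 0 <= mass z by do 3![apply: sumr_ge0 => ? _].
have num0 z i a : 0 <= num z i a by do 3![apply: sumr_ge0 => ? _].
have numE z i : \sum_a num z i a = mass z.
  rewrite exchange_big; apply: eq_bigr => x _ /=.
  by rewrite [RHS](partition_big (fun s : {ffun 'I_k -> S} => s i) predT).
(* If [z] has mass 0, the posterior takes its default value 0, and the numerator vanishes too. *)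
have num_post z i a : num z i a = mass z * posterior M p i z a.
  rewrite /posterior -/(mass z) -/(num z i a).
  have [h0|h0] := eqVneq (mass z) 0; last by rewrite mulrC divfK.
  rewrite h0 mul0r; apply/eqP; rewrite eq_le num0 andbT -h0 -(numE z i).
  by rewrite (bigD1 a) //= lerDl sumr_ge0.
have distE g : block_distortion M p g =
    \sum_z \sum_i mass z * \sum_a posterior M p i z a * dist M a (g z i).
  rewrite /block_distortion.
  under eq_bigr do under eq_bigr do rewrite exchange_big.
  under eq_bigr do rewrite exchange_big.
  rewrite exchange_big; apply: eq_bigr => z _ /=.
  rewrite /block_dist.
  under eq_bigr do under eq_bigr do under eq_bigr do rewrite mulr_sumr.
  under eq_bigr do under eq_bigr do rewrite exchange_big.
  under eq_bigr do rewrite exchange_big.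
  rewrite exchange_big; apply: eq_bigr => i _ /=.
  rewrite mulr_sumr; under [RHS]eq_bigr do rewrite mulrA -num_post mulr_suml.
  rewrite [RHS]exchange_big; apply: eq_bigr => x _ /=.
  rewrite (partition_big (fun s : {ffun 'I_k -> S} => s i) predT) //=.
  apply: eq_bigr => a _; rewrite mulr_suml; apply: eq_bigr => s /eqP <-.
  by rewrite mulr_suml.
rewrite !distE; apply: ler_sum => z _; apply: ler_sum => i _.
by rewrite ler_wpM2l.
Qed.

Lemma block_channel_cat k l (x1 : {ffun 'I_k -> X}) (x2 : {ffun 'I_l -> X})
    s1 s2 y1 y2 z1 z2 :
  block_channel M (ffun_cat x1 x2) (ffun_cat s1 s2) (ffun_cat y1 y2)
    (ffun_cat z1 z2) = block_channel M x1 s1 y1 z1 * block_channel M x2 s2 y2 z2.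
Proof.
rewrite /block_channel big_split_ord /=; congr (_ * _); apply: eq_bigr => i _.
  by rewrite !ffun_cat_lshift.
by rewrite !ffun_cat_rshift.
Qed.

Lemma block_dist_cat k l (s1 : {ffun 'I_k -> S}) (s2 : {ffun 'I_l -> S}) t1 t2 :
  block_dist M (ffun_cat s1 s2) (ffun_cat t1 t2) =
  block_dist M s1 t1 + block_dist M s2 t2.
Proof.
rewrite /block_dist big_split_ord /=; congr (_ + _); apply: eq_bigr => i _.
  by rewrite !ffun_cat_lshift.
by rewrite !ffun_cat_rshift.
Qed.

Lemma sum_ffun_cat (T : finType) k l (F : {ffun 'I_(k + l) -> T} -> R) :
  \sum_f F f = \sum_f1 \sum_f2 F (ffun_cat f1 f2).
Proof.
by rewrite (reindex _ (onW_bij _ (@ffun_cat_bij k l T))) sum_pair.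
Qed.

Lemma receiver_channel_cat k l (x1 : {ffun 'I_k -> X}) (x2 : {ffun 'I_l -> X})
    s1 s2 y1 y2 :
  receiver_channel (ffun_cat x1 x2) (ffun_cat s1 s2, ffun_cat y1 y2) =
  receiver_channel x1 (s1, y1) * receiver_channel x2 (s2, y2).
Proof.
rewrite /receiver_channel sum_ffun_cat big_distrlr /=.
apply: eq_bigr => z1 _; apply: eq_bigr => z2 _; exact: block_channel_cat.
Qed.

Definition estimator_cat k l (h1 : {ffun 'I_k -> Z} -> {ffun 'I_k -> Sh})
    (h2 : {ffun 'I_l -> Z} -> {ffun 'I_l -> Sh}) (z : {ffun 'I_(k + l) -> Z}) :=
  ffun_cat (h1 (ffun_left z)) (h2 (ffun_right z)).

Lemma input_distortion_cat k l (x1 : {ffun 'I_k -> X}) (x2 : {ffun 'I_l -> X})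
    h1 h2 :
  input_distortion (estimator_cat h1 h2) (ffun_cat x1 x2) =
  input_distortion h1 x1 + input_distortion h2 x2.
Proof.
pose c1 s y z := block_channel M x1 s y z.
pose c2 s y z := block_channel M x2 s y z.
transitivity (\sum_s1 \sum_s2 \sum_y1 \sum_y2 \sum_z1 \sum_z2
  (c1 s1 y1 z1 * block_dist M s1 (h1 z1) * c2 s2 y2 z2 +
   c1 s1 y1 z1 * (c2 s2 y2 z2 * block_dist M s2 (h2 z2)))).
  rewrite /input_distortion sum_ffun_cat.
  apply: eq_bigr => s1 _; apply: eq_bigr => s2 _; rewrite sum_ffun_cat.
  apply: eq_bigr => y1 _; apply: eq_bigr => y2 _; rewrite sum_ffun_cat.
  apply: eq_bigr => z1 _; apply: eq_bigr => z2 _.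
  rewrite block_channel_cat /estimator_cat ffun_left_cat ffun_right_cat.
  by rewrite block_dist_cat /c1 /c2; ring.
(* Each block's distortion is multiplied by the total mass 1 of the other block's channel. *)
rewrite /input_distortion -[X in X + _]mulr1 -[X in _ + X]mul1r.
rewrite -{1}(sum_block_channel x2) -(sum_block_channel x1).
rewrite !mulr_suml -big_split; apply: eq_bigr => s1 _.
rewrite !mulr_sumr -big_split; apply: eq_bigr => s2 _ /=.
rewrite !mulr_suml -big_split; apply: eq_bigr => y1 _ /=.
rewrite !mulr_sumr -big_split; apply: eq_bigr => y2 _ /=.
rewrite !mulr_suml -big_split; apply: eq_bigr => z1 _ /=.
by rewrite !mulr_sumr -big_split.
Qed.

(** The distortion at time [i] is a product over all times with factors 1 elsewhere, so the sum
    factorises and the other letters sum to 1. *)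
Lemma input_distortion_const k (x0 : X) (g : Z -> Sh) :
  input_distortion (fun z : {ffun 'I_k -> Z} => [ffun i => g (z i)])
    [ffun=> x0] = k%:R * letter_distortion x0 g.
Proof.
pose w s y z := state_pmf M s * channel M x0 s (y, z).
transitivity (\sum_(i < k) \sum_(s : {ffun 'I_k -> S})
  \sum_(y : {ffun 'I_k -> Y}) \sum_(z : {ffun 'I_k -> Z})
  \prod_j (w (s j) (y j) (z j) * if j == i then dist M (s j) (g (z j)) else 1)).
  rewrite [RHS]exchange_big; apply: eq_bigr => s _ /=.
  rewrite [RHS]exchange_big; apply: eq_bigr => y _ /=.
  rewrite [RHS]exchange_big; apply: eq_bigr => z _ /=.
  rewrite /block_dist mulr_sumr; apply: eq_bigr => i _.
  rewrite big_split -big_mkcond big_pred1_eq ffunE; congr (_ * _).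
  by apply: eq_bigr => j _; rewrite ffunE.
rewrite -[k in RHS]card_ord mulr_natl -sumr_const; apply: eq_bigr => i _.
rewrite (sum3_prod (fun j a b c => w a b c *
  if j == i then dist M a (g c) else 1)) (bigD1 i) //= eqxx.
rewrite [X in _ * X]big1 ?mulr1 // => j /negbTE ->.
under eq_bigr do under eq_bigr do under eq_bigr do rewrite mulr1.
rewrite -(state_pmfP M).2; apply: eq_bigr => s _.
under eq_bigr do rewrite -mulr_sumr.
by rewrite -mulr_sumr sum_letter_channel mulr1.
Qed.

(** There are finitely many pairs of a letter and a letterwise estimator, so one is minimal, and
    averaging over an input pmf cannot go below it. *)
Lemma exists_best_letter : (0 < #|X|)%N -> (0 < #|Sh|)%N ->
  exists x0 g0, letter_distortion x0 g0 <= Dmin M.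
Proof.
move=> /card_gt0P[x _] /card_gt0P[t _].
pose F (u : X * {ffun Z -> Sh}) := letter_distortion u.1 u.2.
have [[x0 g0] _ h0] := @arg_minP _ R _ (x, [ffun=> t]) predT F isT.
exists x0, g0; apply: lb_le_inf.
  exists (\sum_x1 \sum_s \sum_y \sum_z point_mass R x x1 * state_pmf M s *
    channel M x1 s (y, z) * dist M s t), (point_mass R x), (fun=> t).
  by split=> //; exact: point_mass_is_pmf.
move=> _ [p [g [hp ->]]].
rewrite (_ : (\sum_x1 _) = \sum_x1 p x1 * letter_distortion x1 g); last first.
  apply: eq_bigr => x1 _; rewrite mulr_sumr; apply: eq_bigr => s _.
  rewrite mulr_sumr; apply: eq_bigr => y _.
  by rewrite mulr_sumr; apply: eq_bigr => z _; rewrite !mulrA.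
apply: pmf_mean_le => // x1; apply: le_trans (h0 (x1, finfun g) isT) _.
rewrite le_eqVlt; apply/orP; left; apply/eqP.
by do 3![apply: eq_bigr => ? _]; rewrite ffunE.
Qed.

(** Induction on [m]: the base case is [l] letters [x0], of density 1, and each step prepends an
    independent copy of the block with its own estimator. *)
Lemma repeat_block k (p : {ffun 'I_k -> X} -> R) h (x0 : X) (g0 : Z -> Sh)
    (m l : nat) : is_pmf p ->
  exists (q : {ffun 'I_(m * k + l) -> X} -> R) h',
    [/\ is_pmf q,
        \sum_x q x * input_distortion h' x =
          m%:R * (\sum_x p x * input_distortion h x) +
          l%:R * letter_distortion x0 g0,
        mutual_info (@receiver_channel _) q =
          m%:R * mutual_info (@receiver_channel _) p
      & forall t, density_mgf (@receiver_channel _) q t =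
          density_mgf (@receiver_channel _) p t ^+ m].
Proof.
move=> hp; elim: m => [|m [q [h' [hq qd qi qm]]]].
  rewrite mul0n add0n; exists (point_mass R [ffun=> x0]).
  exists (fun z => [ffun i => g0 (z i)]); split=> [|||t].
  - exact: point_mass_is_pmf.
  - by rewrite point_mass_mean input_distortion_const mul0r add0r.
  - by rewrite mutual_info_point_mass ?mul0r //; exact: receiver_channel_is_pmf.
  - by rewrite density_mgf_point_mass //; exact: receiver_channel_is_pmf.
rewrite mulSn -addnA; set n := (m * k + l)%N in q h' hq qd qi qm *.
pose q' (x : {ffun 'I_(k + n) -> X}) := p (ffun_left x) * q (ffun_right x).
have q'E x1 x2 : q' (ffun_cat x1 x2) = p x1 * q x2.
  by rewrite /q' ffun_left_cat ffun_right_cat.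
pose eB (u : ({ffun 'I_k -> S} * {ffun 'I_k -> Y}) *
             ({ffun 'I_n -> S} * {ffun 'I_n -> Y})) :=
  (ffun_cat u.1.1 u.2.1, ffun_cat u.1.2 u.2.2).
have eB_bij : bijective eB.
  exists (fun b => ((ffun_left b.1, ffun_left b.2),
                    (ffun_right b.1, ffun_right b.2))).
    by move=> [[? ?] [? ?]]; rewrite /= !ffun_left_cat !ffun_right_cat.
  by move=> [? ?]; rewrite /eB /= !ffun_catK.
have WE x1 x2 b1 b2 : receiver_channel (ffun_cat x1 x2) (eB (b1, b2)) =
    receiver_channel x1 b1 * receiver_channel x2 b2.
  by case: b1 b2 => [s1 y1] [s2 y2]; exact: receiver_channel_cat.
exists q', (estimator_cat h h'); split=> [|||t].
- split=> [x|]; first by rewrite mulr_ge0 ?(hp.1) ?(hq.1).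
  rewrite sum_ffun_cat; under eq_bigr do under eq_bigr do rewrite q'E.
  by rewrite -big_distrlr /= hp.2 hq.2 mulr1.
- rewrite sum_ffun_cat.
  under eq_bigr do under eq_bigr do rewrite q'E input_distortion_cat mulrDr.
  under eq_bigr do rewrite big_split.
  rewrite big_split /=.
  rewrite [X in X + _](_ : _ = \sum_x p x * input_distortion h x); last first.
    apply: eq_bigr => x1 _; under eq_bigr do rewrite mulrAC.
    by rewrite -mulr_sumr hq.2 mulr1.
  rewrite [X in _ + X](_ : _ = \sum_x q x * input_distortion h' x); last first.
    under eq_bigr do under eq_bigr do rewrite -mulrA.
    by rewrite -big_distrlr /= hp.2 mul1r.
  by rewrite qd -[in RHS]natr1; ring.
- rewrite (mutual_info_product (ffun_cat_bij _ _ _) eB_bij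
    (@receiver_channel_is_pmf _) (@receiver_channel_is_pmf _) hp hq WE q'E) qi.
  by rewrite -[in RHS]natr1; ring.
- by rewrite (density_mgf_product (ffun_cat_bij _ _ _) eB_bij
    (@receiver_channel_is_pmf _) (@receiver_channel_is_pmf _) hp hq WE q'E) qm
    exprS.
Qed.

End BlockChannel.

(** * Limits and the number of messages *)

Lemma limn_esup_le_near (R : realType) (u : nat -> R) (l : R) :
  (limn_esup (fun n => (u n)%:E) <= l%:E)%E <->
  forall e : R, 0 < e -> \forall n \near \oo, u n <= l + e.
Proof.
rewrite /limn_esup limf_esupE; split=> [h e e0|h].
  have : (ereal_inf [set ereal_sup [set (u x)%:E | x in V] | V in \oo] <
      (l + e)%:E)%E by rewrite (le_lt_trans h) // lte_fin ltrDl.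
  move=> /ereal_inf_lt[_ [V VF <-] hV]; apply: filterS VF => n Vn.
  rewrite -lee_fin (le_trans _ (ltW hV)) //.
  by apply: ereal_sup_ubound; exists n.
apply/lee_addgt0Pr => e e0; apply: ge_ereal_inf.
exists (ereal_sup [set (u x)%:E | x in [set n | u n <= l + e]]).
  by exists [set n | u n <= l + e] => //; exact: h.
by apply: ge_ereal_sup => _ [n /= hn <-]; rewrite -EFinD lee_fin.
Qed.

Lemma cvg_expr_divn (R : realType) (rho : R) (k : nat) :
  0 < rho < 1 -> (0 < k)%N -> (fun n => rho ^+ (n %/ k)%N) @ \oo --> (0 : R).
Proof.
move=> /andP[r0 r1] k0; apply/cvgrPdist_le => e e0.
have hc : (fun n => rho ^+ n) @ \oo --> (0 : R).
  by apply: cvg_expr; rewrite gtr0_norm.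
have [N _ hN] := (cvgrPdist_le _ _).1 hc e e0.
near=> n; apply: hN => /=.
by rewrite leq_divRL //; near: n; exact: nbhs_infty_ge.
Unshelve. all: by end_near.
Qed.

Lemma num_messages_gt0 (R : realType) (r : R) (n : nat) :
  (0 < num_messages r n)%N.
Proof.
have h : 0 < Num.ceil (2 `^ (n%:R * r)) by rewrite ceil_gt0 powR_gt0.
by rewrite /num_messages absz_gt0 gt_eqF.
Qed.

(** The argument of the ceiling is at least 1, so rounding up at most doubles it. *)
Lemma num_messages_bounds (R : realType) (r : R) (n : nat) : 0 <= r ->
  expR (n%:R * r * ln 2) <= ((num_messages r n)%:R : R) <=
  2 * expR (n%:R * r * ln 2).
Proof.
move=> r0; have -> : expR (n%:R * r * ln 2) = 2 `^ (n%:R * r) :> R.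
  by rewrite /powR pnatr_eq0.
set v := _ `^ _.
have v1 : 1 <= v.
  rewrite -[leLHS](powRr0 2) /v.
  by apply: ler_powR; rewrite ?ler1n // mulr_ge0.
have -> : (num_messages r n)%:R = (Num.ceil v)%:~R :> R.
  rewrite /num_messages -/v natr_absz ger0_norm // ltW // ceil_gt0.
  exact: lt_le_trans v1.
rewrite ceil_ge /=.
have := ceilB1_lt v; rewrite intrD; lra.
Qed.

(** * Codes for the block channel and inputs of arbitrary length *)

Section Codes.
Variables (R : realType) (X S Y Z Sh : finType).
Variable M : bistatic_isac R X S Y Z Sh.

Let V k := @receiver_channel R X S Y Z Sh M k.

Lemma error_probE (m n : nat) (c : Defs.code X S Y Z Sh m n) :
  error_prob M c =
  channel_error (@V n) (encoder c) (fun b => decoder c b.2 b.1).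
Proof.
apply: eq_bigr => w _; rewrite sum_pair.
apply: eq_bigr => s _; apply: eq_bigr => y _.
by rewrite mulr_sumr mulr_suml.
Qed.

Lemma code_distortionE (m n : nat) (c : Defs.code X S Y Z Sh m n) :
  code_distortion M c = n%:R^-1 * (m%:R^-1 *
    \sum_w input_distortion M (estimator c) (encoder c w)).
Proof.
congr (_ * _); rewrite exchange_big mulr_sumr; apply: eq_bigr => w _ /=.
rewrite exchange_big mulr_sumr; apply: eq_bigr => s _ /=.
rewrite exchange_big mulr_sumr; apply: eq_bigr => y _ /=.
rewrite exchange_big mulr_sumr; apply: eq_bigr => z _ /=.
by rewrite -mulr_sumr mulrA.
Qed.

Lemma code_distortion_ge0 (m n : nat) (c : Defs.code X S Y Z Sh m n) :
  0 <= code_distortion M c.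
Proof.
rewrite code_distortionE !mulr_ge0 // sumr_ge0 // => w _.
exact: input_distortion_ge0.
Qed.

Lemma error_prob_ge0 (m n : nat) (c : Defs.code X S Y Z Sh m n) :
  0 <= error_prob M c.
Proof.
do 4![apply: sumr_ge0 => ? _].
by rewrite !mulr_ge0 ?block_channel_ge0.
Qed.

(** The weight [lam] is left free: taken large, it lets a single bound on the sum control the error
    as well as the distortion. *)
Lemma random_code (m n : nat) (q : {ffun 'I_n -> X} -> R) h (c t lam : R) :
  is_pmf q -> (0 < m)%N -> 0 <= lam -> 0 <= t ->
  exists C : Defs.code X S Y Z Sh m n,
    lam * error_prob M C + code_distortion M C <=
    lam * (expR (t * c) * density_mgf (@V n) q t + m%:R * expR (- c)) +
    n%:R^-1 * \sum_x q x * input_distortion M h x.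
Proof.
move=> hq m0 lam0 t0.
have [enc [dec hC]] := random_coding (@receiver_channel_is_pmf _ _ _ _ _ _ M n)
  (fun x => n%:R^-1 * input_distortion M h x) c hq m0 lam0.
exists (Code enc (fun y s => dec (s, y)) h).
rewrite error_probE code_distortionE /=.
have -> : channel_error (@V n) enc (fun b => dec (b.1, b.2)) =
    channel_error (@V n) enc dec.
  by apply: eq_bigr => w _; apply: eq_bigr => -[].
rewrite mulrCA [n%:R^-1 * \sum_w _]mulr_sumr (le_trans hC) //.
have -> : \sum_x q x * (n%:R^-1 * input_distortion M h x) =
    n%:R^-1 * \sum_x q x * input_distortion M h x.
  by rewrite mulr_sumr; apply: eq_bigr => x _; rewrite mulrCA.
rewrite lerD2r ler_wpM2l // lerD2r.
by apply: chernoff_density => //; exact: receiver_channel_is_pmf.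
Qed.

(** Fano's inequality in bits, with at least [2 ^ (n r)] messages; its term [ln 2] becomes 1. *)
Lemma code_fano (r : R) (n : nat)
    (C : Defs.code X S Y Z Sh (num_messages r n) n) :
  0 <= r -> error_prob M C <= 1 ->
  (1 - error_prob M C) * (n%:R * r) <=
  mutual_info (@V n) (codebook_pmf R (encoder C)) / ln 2 + 1.
Proof.
move=> r0 hC; have ln2 : 0 < ln 2 :> R by rewrite ln_gt0 // ltr1n.
rewrite -(ler_pM2r ln2) [leRHS]mulrDl divfK ?gt_eqF // mul1r.
have := fano (@receiver_channel_is_pmf _ _ _ _ _ _ M n) (encoder C)
  (fun b => decoder C b.2 b.1) (num_messages_gt0 r n).
rewrite -error_probE; apply: le_trans.
rewrite -mulrA ler_wpM2l ?subr_ge0 //.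
have /andP[h _] := num_messages_bounds n r0.
by rewrite -ler_expR lnK // posrE ltr0n num_messages_gt0.
Qed.

Lemma codebook_distortion (m n : nat) (C : Defs.code X S Y Z Sh m n) : (0 < n)%N ->
  \sum_x codebook_pmf R (encoder C) x * input_distortion M (estimator C) x =
  n%:R * code_distortion M C.
Proof.
move=> n0; rewrite codebook_mean code_distortionE mulVKf ?mulr_sumr //.
by rewrite pnatr_eq0 -lt0n.
Qed.

(** Euclidean division of [n] by [k]: the [n %% k] leftover positions hold [x0], whose distortion is
    at most [D], so every length is reached. *)
Lemma repeat_block_to k (p : {ffun 'I_k -> X} -> R) h (x0 : X) (g0 : Z -> Sh)
    (D : R) (n : nat) : is_pmf p ->
  \sum_x p x * input_distortion M h x <= k%:R * D ->
  letter_distortion M x0 g0 <= D ->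
  exists (q : {ffun 'I_n -> X} -> R) h',
    [/\ is_pmf q, \sum_x q x * input_distortion M h' x <= n%:R * D,
        mutual_info (@V n) q = (n %/ k)%:R * mutual_info (@V k) p
      & forall t, density_mgf (@V n) q t = density_mgf (@V k) p t ^+ (n %/ k)].
Proof.
move=> hp hd h0.
have [q [h' [hq qd qi qm]]] := repeat_block M h x0 g0 (n %/ k) (n %% k) hp.
have E := divn_eq n k; rewrite -E in q h' hq qd qi qm.
exists q, h'; split=> //; rewrite qd [in n%:R]E natrD natrM mulrDl.
by rewrite lerD // ?ler_wpM2l // -mulrA ler_wpM2l.
Qed.

End Codes.

(** * Convergence of the block values *)

Section Capacity.
Variables (R : realType) (X S Y Z Sh : finType).
Variable M : bistatic_isac R X S Y Z Sh.
Hypothesis hX : (0 < #|X|)%N.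
Variable est : forall k : nat, ({ffun 'I_k -> X} -> R) ->
                         {ffun 'I_k -> Z} -> {ffun 'I_k -> Sh}.
Hypothesis hest : forall (k : nat) (p : {ffun 'I_k -> X} -> R),
            is_pmf p -> optimal_estimator M p (est p).
Variables (D : R) (x0 : X) (g0 : Z -> Sh).
Hypothesis hD : letter_distortion M x0 g0 <= D.

Let V k := @receiver_channel R X S Y Z Sh M k.
Let e0 := letter_distortion M x0 g0.
Let cap := block_capacity M (@est) D.
Let feasible k := [set I | exists p : {ffun 'I_k -> X} -> R,
    [/\ is_pmf p, block_distortion M p (est p) <= k%:R * D
      & I = block_cond_mutual_info M p]].

Let ln2_gt0 : 0 < ln 2 :> R. Proof. by rewrite ln_gt0 // ltr1n. Qed.

Lemma block_mutual_info_le k (p : {ffun 'I_k -> X} -> R) : is_pmf p ->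
  mutual_info (@V k) p <= k%:R * ln #|X|%:R.
Proof.
move=> hp; have hX' : (0 : R) < #|X|%:R by rewrite ltr0n.
have card0 : (0 < #|{ffun 'I_k -> X}|)%N by rewrite card_ffun expn_gt0 hX.
have := mutual_info_le_ln_card (@receiver_channel_is_pmf _ _ _ _ _ _ M k) hp card0.
move=> /le_trans; apply.
by rewrite card_ffun card_ord natrX lnXn // mulr_natl.
Qed.

Lemma feasible_has_ubound k : has_ubound (feasible k).
Proof.
exists (k%:R * ln #|X|%:R / ln 2) => _ [p [hp _ ->]].
rewrite block_cond_mutual_infoE // ler_wpM2r ?invr_ge0 ?(ltW ln2_gt0) //.
exact: block_mutual_info_le.
Qed.

Lemma feasible_neq0 k : feasible k !=set0.
Proof.
pose p := point_mass R ([ffun=> x0] : {ffun 'I_k -> X}).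
have hp : is_pmf p by exact: point_mass_is_pmf.
exists (block_cond_mutual_info M p), p; split=> //.
have := optimal_estimator_le (fun z => [ffun i => g0 (z i)]) hp (hest hp).
move=> /le_trans; apply.
rewrite block_distortionE point_mass_mean input_distortion_const.
by rewrite ler_wpM2l.
Qed.

(** Any estimator [h] certifies feasibility, because the optimal one does at least as well. *)
Lemma le_block_capacity k (p : {ffun 'I_k -> X} -> R) h : (0 < k)%N ->
  is_pmf p -> \sum_x p x * input_distortion M h x <= k%:R * D ->
  mutual_info (@V k) p / ln 2 <= k%:R * cap k.
Proof.
move=> k0 hp hd.
rewrite /cap /block_capacity mulVKf ?pnatr_eq0 -?lt0n //.
apply: ub_le_sup; first exact: feasible_has_ubound.
exists p; split=> //; last by rewrite block_cond_mutual_infoE.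
by rewrite (le_trans (optimal_estimator_le h hp (hest hp))) ?block_distortionE.
Qed.

Lemma block_capacity_le k : (0 < k)%N -> cap k <= ln #|X|%:R / ln 2.
Proof.
move=> k0; have k0' : (0 : R) < k%:R by rewrite ltr0n.
rewrite /cap /block_capacity mulrC ler_pdivrMr //.
apply: ge_sup; first exact: feasible_neq0.
move=> _ [p [hp _ ->]]; rewrite block_cond_mutual_infoE //.
by rewrite mulrAC ler_wpM2r ?invr_ge0 ?(ltW ln2_gt0) // mulrC block_mutual_info_le.
Qed.

(** The shift starts at block length 1, as [0^-1] is a mere default value. *)
Definition limit_capacity := sup (range (fun k => cap k.+1)).
Local Notation L := limit_capacity.

Lemma range_capacity_has_sup : has_sup (range (fun k => cap k.+1)).
Proof.
split; first by exists (cap 1), 0%N.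
by exists (ln #|X|%:R / ln 2) => _ [k _ <-]; exact: block_capacity_le.
Qed.

Lemma block_capacity_le_limit k : (0 < k)%N -> cap k <= L.
Proof.
case: k => // k _; apply: ub_le_sup; first exact: range_capacity_has_sup.2.
by exists k.
Qed.

Lemma limit_capacity_adherent e : 0 < e ->
  exists k (p : {ffun 'I_k -> X} -> R) h,
  [/\ (0 < k)%N, is_pmf p, \sum_x p x * input_distortion M h x <= k%:R * D
    & L - e < mutual_info (@V k) p / ln 2 / k%:R].
Proof.
(* One half of [e] is spent on the supremum over lengths, the other, scaled by the length, on the
   supremum over input pmfs. *)
move=> e0'; have e2 : 0 < e / 2 by rewrite divr_gt0.
have [_ [k _ <-] hk] := sup_adherent e2 range_capacity_has_sup.
have k0 : (0 : R) < k.+1%:R by rewrite ltr0n.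
have [_ [p [hp hd ->]] hI] := sup_adherent (mulr_gt0 k0 e2)
  (conj (feasible_neq0 k.+1) (feasible_has_ubound k.+1)).
exists k.+1, p, (est p); split=> //; first by rewrite -block_distortionE.
rewrite -block_cond_mutual_infoE // ltr_pdivlMr //.
apply: le_lt_trans hI.
have hc : cap k.+1 * k.+1%:R = sup (feasible k.+1).
  by rewrite /cap /block_capacity mulrC mulVKf // gt_eqF.
rewrite -/L in hk; rewrite -hc mulrC -[cap _ * _]mulrC -mulrBr ler_pM2l //; lra.
Qed.

Lemma block_capacity_cvg : cap @ \oo --> L.
Proof.
apply/cvgrPdist_le => e he.
have [k [p [h [k0 hp hd hv]]]] := limit_capacity_adherent (divr_gt0 he (ltr0n R 2)).
set v := _ / _ / _ in hv.
have kp : (0 : R) < k%:R by rewrite ltr0n.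
have vE : mutual_info (@V k) p / ln 2 = k%:R * v.
  by rewrite /v [RHS]mulrC divfK // gt_eqF.
clearbody v; near=> n.
have n0 : (0 < n)%N by near: n; exact: nbhs_infty_gt.
have n0' : (0 : R) < n%:R by rewrite ltr0n.
(* From this length on, the incomplete last block costs at most [k * |v| < n * e / 2]. *)
have hn : 2 * k%:R * `|v| / e < n%:R by near: n; exact: nbhs_infty_gtr.
have [q [h' [hq qd qi _]]] := repeat_block_to n hp hd hD.
have := le_block_capacity n0 hq qd; rewrite qi => hc.
have := block_capacity_le_limit n0 => hL.
rewrite ger0_norm ?subr_ge0 //.
rewrite -/(cap n) in hc hL *.
have E : (n%:R : R) = (n %/ k)%:R * k%:R + (n %% k)%:R.
  by rewrite -natrM -natrD -divn_eq.
have hmod : ((n %% k)%:R : R) <= k%:R by rewrite ler_nat ltnW // ltn_mod.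
have h1 : n%:R * v - k%:R * `|v| <= n%:R * cap n.
  apply: le_trans hc; rewrite -mulrA vE mulrA E mulrDl -addrA gerDl.
  rewrite subr_le0 (le_trans (ler_norm _)) // normrM normr_nat.
  by rewrite ler_wpM2r.
have h2 : 2 * k%:R * `|v| < n%:R * e by rewrite -ltr_pdivrMr.
rewrite -(ler_pM2l n0') mulrBr.
have h3 : n%:R * (L - e / 2) <= n%:R * v by rewrite ler_pM2l // ltW.
have h4 : n%:R * (L - e / 2) = n%:R * L - n%:R * e / 2 by rewrite mulrBr mulrA.
lra.
Unshelve. all: by end_near.
Qed.

(** * Achievability *)

Lemma achievable0 : achievable M 0 D.
Proof.
(* At rate 0 there is a single message, so decoding cannot fail. *)
have h1 n : num_messages (0 : R) n = 1%N.
  by rewrite /num_messages mulr0 powRr0 ceil1.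
pose c n : Defs.code X S Y Z Sh (num_messages (0 : R) n) n :=
  Code (fun=> [ffun=> x0]) (fun _ _ => Ordinal (num_messages_gt0 (0 : R) n))
    (fun z => [ffun i => g0 (z i)]).
have all_eq n (i j : 'I_(num_messages (0 : R) n)) : i = j.
  have val0 (u : 'I_(num_messages (0 : R) n)) : val u = 0%N.
    by apply/eqP; rewrite -leqn0 -ltnS -(h1 n) ltn_ord.
  by apply: val_inj; rewrite !val0.
exists c; split.
  rewrite (_ : (fun n => _) = fun=> 0); first exact: cvg_cst.
  apply/funext => n; apply: big1 => w _; do 3![apply: big1 => ? _].
  by rewrite (all_eq _ (decoder _ _ _) w) eqxx mulr0.
apply/limn_esup_le_near => e he; apply: nearW => n.
rewrite code_distortionE /c /= sumr_const card_ord input_distortion_const.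
rewrite -[_ * _ *+ _]mulr_natl mulKf; last first.
  by rewrite pnatr_eq0 -lt0n num_messages_gt0.
have D0 : 0 <= e0.
  by do 3![apply: sumr_ge0 => ? _]; rewrite !mulr_ge0 ?dist_ge0 //
    ?(state_pmfP M).1 ?(channelP M _ _).1.
have [->|n0] := eqVneq n 0%N.
  by rewrite mul0r mulr0 addr_ge0 ?(ltW he) // (le_trans D0).
by rewrite mulKf ?pnatr_eq0 // (le_trans hD) // lerDl ltW.
Qed.

Lemma achievable_lt_limit r : 0 <= r -> r < L -> achievable M r D.
Proof.
move=> r0 rL.
have [k [p [h [k0 hp hd hv]]]] : exists k (p : {ffun 'I_k -> X} -> R) h,
  [/\ (0 < k)%N, is_pmf p, \sum_x p x * input_distortion M h x <= k%:R * D
    & r < mutual_info (@V k) p / ln 2 / k%:R].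
  have d0 : 0 < L - r by rewrite subr_gt0.
  have [k [p [h [k0 hp hd hv]]]] := limit_capacity_adherent d0.
  by exists k, p, h; split=> //; move: hv; rewrite opprB addrC subrK.
have kp : (0 : R) < k%:R by rewrite ltr0n.
have [K [t0 t0_gt0 [K0 hmgf]]] :=
  density_mgf_small (@receiver_channel_is_pmf _ _ _ _ _ _ M k) hp.
set I := mutual_info _ p in hv hmgf.
(* The gap, in nats per block, between information and rate. *)
pose eta := I - k%:R * r * ln 2.
have eta0 : 0 < eta.
  by rewrite subr_gt0 -ltr_pdivlMr // mulrC -ltr_pdivlMr.
have D0 : 0 <= D.
  apply: le_trans hD; do 3![apply: sumr_ge0 => ? _].
  by rewrite !mulr_ge0 ?dist_ge0 // ?(state_pmfP M).1 ?(channelP M _ _).1.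
(* The second bound gives [t * K <= eta / 4], so the quadratic term uses up at most half of the
   linear gain [eta / 2]. *)
pose t := Num.min t0 (eta / (4 * (K + 1))).
have K1 : 0 < 4 * (K + 1) by lra.
have t_gt0 : 0 < t by rewrite lt_min t0_gt0 divr_gt0.
have t_le : t * (4 * (K + 1)) <= eta.
  by rewrite -ler_pdivlMr // ge_min lexx orbT.
have tK : t * K <= eta / 4.
  rewrite ler_pdivlMr // (le_trans _ t_le) // -mulrA ler_pM2l //; lra.
have ht : density_mgf (@V k) p t <= expR (- (t * I) + t ^+ 2 * K).
  by apply: hmgf; rewrite ltW //= ge_min lexx.
(* The exponent per block: [t * eta / 4] for a sent codeword of low density, [eta / 2] for rivals of
   high density. *)
pose alpha := Num.min (t * eta / 4) (eta / 2).
have alpha0 : 0 < alpha by rewrite lt_min !divr_gt0 // mulr_gt0.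
(* Half of the exponent: the error is of order [rho ^ (2 m)], so even with the weight [rho ^ (- m)]
   it tends to 0. *)
pose rho := expR (- (alpha / 2)).
have rho01 : 0 < rho < 1.
  by rewrite expR_gt0 /= -expR0 ltr_expR oppr_lt0 divr_gt0.
(* The 1 is for the Chernoff term; the 2 comes from rounding up the number of messages, and the
   exponential from the incomplete last block. *)
pose C := 1 + 2 * expR (k%:R * r * ln 2).
have C0 : 0 <= C by rewrite addr_ge0 // mulr_ge0 // expR_ge0.
have codes n : exists c : Defs.code X S Y Z Sh (num_messages r n) n,
    (rho ^+ (n %/ k))^-1 * error_prob M c + code_distortion M c <=
    C * rho ^+ (n %/ k) + D.
  have [q [h' [hq qd _ qm]]] := repeat_block_to n hp hd hD.
  set m := (n %/ k)%N in qm *.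
  (* The threshold lies halfway between rate and information, at [I - eta / 2] per block. *)
  pose c := m%:R * (k%:R * r * ln 2 + eta / 2).
  have rm : 0 < rho ^+ m by rewrite exprn_gt0 // expR_gt0.
  have rmE : rho ^+ m = expR (- (m%:R * alpha / 2)).
    by rewrite -expRM_natl mulrN mulrA.
  have lam0 : 0 <= (rho ^+ m)^-1 by rewrite invr_ge0 ltW.
  have [c0 hc0] := random_code M h' c hq (num_messages_gt0 r n) lam0 (ltW t_gt0).
  exists c0; apply: le_trans hc0 _; apply: lerD; last first.
    have [n0|n0] := eqVneq n 0%N.
      by rewrite (_ : n%:R^-1 = 0 :> R) ?mul0r // n0 invr0.
    by rewrite mulrC ler_pdivrMr ?ltr0n ?lt0n // mulrC.
  rewrite ler_pdivrMl // [leRHS]mulrCA -expr2 rmE -expRM_natl.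
  have -> : 2 * - (m%:R * alpha / 2) = - (m%:R * alpha) by field.
  rewrite /C mulrDl mul1r; apply: lerD.
    rewrite qm -/m.
    apply: (@le_trans _ _ (expR (t * c) * expR (m%:R * (- (t * I) + t ^+ 2 * K)))).
      rewrite ler_pM2l ?expR_gt0 // expRM_natl lerXn2r // nnegrE ?expR_ge0 //.
      do 2![apply: sumr_ge0 => ? _].
      by rewrite !mulr_ge0 ?expR_ge0 ?(hp.1) ?(receiver_channel_is_pmf _ _).1.
    rewrite -expRD ler_expR /c.
    have -> : t * (m%:R * (k%:R * r * ln 2 + eta / 2)) +
      m%:R * (- (t * I) + t ^+ 2 * K) = m%:R * (t * (t * K - eta / 2)).
      by rewrite /eta; field.
    rewrite -[- (m%:R * _)]mulrN ler_wpM2l //.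
    apply: (@le_trans _ _ (- (t * eta / 4))); last by rewrite lerN2 ge_min lexx.
    have : t * (t * K) <= t * (eta / 4) by rewrite ler_pM2l.
    by rewrite mulrBr; lra.
  have /andP[_ hM] := num_messages_bounds n r0.
  apply: (@le_trans _ _ (2 * expR (n%:R * r * ln 2) * expR (- c))).
    by rewrite ler_wpM2r // expR_ge0.
  rewrite -!mulrA ler_pM2l // -!expRD ler_expR !mulrA.
  have hn : n%:R * (r * ln 2) <= (m%:R * k%:R + k%:R) * (r * ln 2) :> R.
    rewrite ler_wpM2r ?mulr_ge0 ?(ltW ln2_gt0) //.
    rewrite -natrM -natrD ler_nat {1}(divn_eq n k) leq_add2l ltnW //.
    by rewrite ltn_mod.
  have ha : m%:R * alpha <= m%:R * (eta / 2).
    by rewrite ler_wpM2l // ge_min lexx orbT.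
  rewrite /c; lra.
pose c n := projT1 (cid (codes n)); have hc n := projT2 (cid (codes n)).
rewrite -/(c _) in hc.
have hcv : (fun n => rho ^+ (n %/ k)) @ \oo --> (0 : R).
  exact: cvg_expr_divn.
have rn n : 0 < rho ^+ (n %/ k) by rewrite exprn_gt0 // expR_gt0.
exists c; split.
  (* Dropping the nonnegative distortion from the joint bound leaves the error; below, dropping the
     error leaves the distortion. *)
  apply: (@squeeze_cvgr _ _ _ _ (fun=> 0)
    (fun n => rho ^+ (n %/ k) * (C * rho ^+ (n %/ k) + D))).
  - apply: nearW => n; rewrite error_prob_ge0 /= -ler_pdivrMl //.
    by apply: le_trans (hc n); rewrite lerDl code_distortion_ge0.
  - exact: cvg_cst.
  - rewrite -[X in _ --> X](mul0r (C * 0 + D)); apply: cvgM => //.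
    by apply: cvgD; [apply: cvgM => //|]; exact: cvg_cst.
apply/limn_esup_le_near => e he.
have he' : 0 < e / (C + 1) by rewrite divr_gt0 // ltr_wpDl.
move/cvgrPdist_le: hcv => /(_ _ he'); apply: filterS => n.
rewrite sub0r normrN gtr0_norm // ler_pdivlMr ?ltr_wpDl // => hn.
have h1 : code_distortion M (c n) <= C * rho ^+ (n %/ k) + D.
  by apply: le_trans (hc n); rewrite lerDr mulr_ge0 ?error_prob_ge0 // invr_ge0 ltW.
have := rn n; lra.
Qed.

(** * Converse *)

Lemma error_prob_near (r e : R)
    (c : forall n, Defs.code X S Y Z Sh (num_messages r n) n) :
  0 < e -> (fun n => error_prob M (c n)) @ \oo --> (0 : R) ->
  \forall n \near \oo, error_prob M (c n) <= e.
Proof.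
move=> he /cvgrPdist_le/(_ _ he); apply: filterS => n.
by rewrite sub0r normrN ger0_norm // error_prob_ge0.
Qed.

(** A crude use of Fano at error 1/2, to bound the set of achievable rates so that its [sup] is
    meaningful. *)
Lemma achievable_le_card r : 0 <= r -> achievable M r D ->
  r <= 2 * (ln #|X|%:R / ln 2 + 1).
Proof.
move=> r0 [c [hc _]].
have half : (0 : R) < 2^-1 by rewrite invr_gt0.
near \oo => n.
have n0 : (0 < n)%N by near: n; exact: nbhs_infty_gt.
have n0' : (1 : R) <= n%:R by rewrite ler1n.
have he : error_prob M (c n) <= 2^-1 by near: n; exact: error_prob_near.
have half1 : 2^-1 <= 1 :> R by rewrite invf_le1 // ler1n.
have h1 := code_fano r0 (le_trans he half1).
have h2 := block_mutual_info_le
  (codebook_is_pmf R (encoder (c n)) (num_messages_gt0 r n)).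
have h3 : mutual_info (@V n) (codebook_pmf R (encoder (c n))) / ln 2 <=
    n%:R * (ln #|X|%:R / ln 2).
  by rewrite mulrA ler_wpM2r ?invr_ge0 ?(ltW ln2_gt0).
have h4 : 2^-1 * (n%:R * r) <= (1 - error_prob M (c n)) * (n%:R * r).
  by rewrite ler_wpM2r ?mulr_ge0 //; lra.
have np : (0 : R) < n%:R by rewrite ltr0n.
rewrite -(ler_pM2l np) mulrCA mulrDr mulr1; lra.
Unshelve. all: by end_near.
Qed.

(* Diluting a code of rate [r] and distortion [D + (D - e0) / N] with a fraction
   [1 / (N + 1)] of constant letters, of distortion [e0], meets the constraint [D]. *)
Lemma achievable_dilution r N e : 0 <= r -> achievable M r D ->
  e0 < D -> (0 < N)%N -> 0 < e -> N%:R * (r - e) <= N.+1%:R * L.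
Proof.
move=> r0 [c [hc hdist]] hD' N0 he.
have Np : (0 : R) < N%:R by rewrite ltr0n.
have hde : 0 < (D - e0) / N%:R by rewrite divr_gt0 // subr_gt0.
(* This error level costs at most [e / 2] of the rate; [r + 1] keeps the divisor positive. *)
have hr : 0 < e / 2 / (r + 1) by rewrite !divr_gt0 // ltr_wpDl.
have hmin : 0 < Num.min 1 (e / 2 / (r + 1)) by rewrite lt_min ltr01.
near \oo => n.
have n0 : (0 < n)%N by near: n; exact: nbhs_infty_gt.
have np : (0 : R) < n%:R by rewrite ltr0n.
have hP : error_prob M (c n) <= Num.min 1 (e / 2 / (r + 1)).
  by near: n; exact: error_prob_near.
move: hP; rewrite le_min => /andP[hP1 hP2].
(* Fano's additive 1 is then less than [n * e / 2]. *)
have hn : 2 / e < n%:R by near: n; exact: nbhs_infty_gtr.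
have hdn : code_distortion M (c n) <= D + (D - e0) / N%:R.
  by near: n; exact: (limn_esup_le_near _ _).1.
set p := codebook_pmf R (encoder (c n)).
have hp : is_pmf p by apply: codebook_is_pmf; exact: num_messages_gt0.
have [q [h' [hq qd qi _]]] :=
  repeat_block M (estimator (c n)) x0 g0 N n hp.
have hI : mutual_info (@V _) q / ln 2 <= (N * n + n)%:R * cap (N * n + n).
  apply: (le_block_capacity (h := h')) hq _; first by rewrite addn_gt0 n0 orbT.
  rewrite qd codebook_distortion // natrD natrM mulrDl -mulrA mulrCA.
  have h1 : n%:R * (N%:R * code_distortion M (c n)) <= n%:R * (N%:R * D + (D - e0)).
    rewrite ler_pM2l //.
    have -> : N%:R * D + (D - e0) = N%:R * (D + (D - e0) / N%:R).
      by field; rewrite gt_eqF.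
    by rewrite ler_pM2l.
  move: h1; rewrite -/e0 => h1; lra.
have hcap : cap (N * n + n) <= L.
  by apply: block_capacity_le_limit; rewrite addn_gt0 n0 orbT.
have hF := code_fano r0 hP1.
rewrite -/p in hF.
have E : (N * n + n)%:R = n%:R * N.+1%:R :> R.
  by rewrite -mulSnr mulnC natrM.
have h2 : N%:R * (mutual_info (@V n) p / ln 2) <= n%:R * (N.+1%:R * L).
  rewrite mulrA -qi (le_trans hI) // E -mulrA ler_pM2l // ler_pM2l //.
rewrite -(ler_pM2l np); apply: le_trans h2.
rewrite mulrCA ler_pM2l //.
have h3 : error_prob M (c n) * (r + 1) <= e / 2 by rewrite -ler_pdivlMr // ltr_wpDl.
have h4 : error_prob M (c n) * r <= e / 2.
  by apply: le_trans h3; rewrite ler_wpM2l ?error_prob_ge0 // lerDl.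
have h5 : n%:R * (error_prob M (c n) * r) <= n%:R * (e / 2) by rewrite ler_pM2l.
have h6 : 2 < n%:R * e by rewrite -ltr_pdivrMr.
have h7 : (1 - error_prob M (c n)) * (n%:R * r) =
    n%:R * r - n%:R * (error_prob M (c n) * r) by ring.
rewrite h7 in hF; rewrite mulrBr; lra.
Unshelve. all: by end_near.
Qed.

(** If [r > L], dilution with [e] half the gap gives [N * (L + e) <= (N + 1) * L], that is
    [N * e <= L], which fails for large [N]. *)
Lemma achievable_le_limit r : 0 <= r -> achievable M r D -> e0 < D -> r <= L.
Proof.
move=> r0 hr hD'; rewrite leNgt; apply/negP => hL.
pose e := (r - L) / 2; have e_gt0 : 0 < e by rewrite divr_gt0 // subr_gt0.
near \oo => N.
have N0 : (0 < N)%N by near: N; exact: nbhs_infty_gt.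
have hN : L / e < N%:R by near: N; exact: nbhs_infty_gtr.
have := achievable_dilution r0 hr hD' N0 e_gt0.
move: hN; rewrite ltr_pdivrMr // -natr1 mulrDl mul1r.
have -> : r - e = L + e by rewrite /e; field.
by rewrite mulrDr; lra.
Unshelve. all: by end_near.
Qed.

(** * Comparison of the capacity with the limit *)

Lemma achievable_has_sup : has_sup [set r | 0 <= r /\ achievable M r D].
Proof.
split; first by exists 0; split => //; exact: achievable0.
exists (2 * (ln #|X|%:R / ln 2 + 1)) => r [r0 hr].
exact: achievable_le_card.
Qed.

Lemma limit_le_capacity_distortion : L <= capacity_distortion M D.
Proof.
rewrite leNgt; apply/negP => hC.
have C0 : 0 <= capacity_distortion M D.
  apply: ub_le_sup; first exact: achievable_has_sup.2.
  by split => //; exact: achievable0.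
(* A midpoint rate would be achievable yet exceed the supremum; it is nonnegative since rate 0 is
   achievable. *)
pose r := (capacity_distortion M D + L) / 2.
have rL : r < L by rewrite /r; lra.
have Cr : capacity_distortion M D < r by rewrite /r; lra.
move: Cr; rewrite ltNge => /negP; apply.
have r0 : 0 <= r by rewrite /r; lra.
apply: ub_le_sup; first exact: achievable_has_sup.2.
by split => //; exact: achievable_lt_limit.
Qed.

Lemma capacity_distortion_le_limit : e0 < D -> capacity_distortion M D <= L.
Proof.
move=> hD'; apply: ge_sup; first exact: achievable_has_sup.1.
by move=> r [r0 hr]; exact: achievable_le_limit.
Qed.

End Capacity.

Theorem theorem1 (R : realType) (X S Y Z Sh : finType)
  (M : bistatic_isac R X S Y Z Sh)
  (hX : (0 < #|X|)%N) (hSh : (0 < #|Sh|)%N)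
  (est : forall k : nat, ({ffun 'I_k -> X} -> R) ->
                         {ffun 'I_k -> Z} -> {ffun 'I_k -> Sh})
  (hest : forall (k : nat) (p : {ffun 'I_k -> X} -> R),
            is_pmf p -> optimal_estimator M p (est k p))
  (D : R) (hD : Dmin M <= D) :
  exists L : R,
    [/\ block_capacity M est D @ \oo --> L,
        L <= capacity_distortion M D
      & Dmin M < D -> capacity_distortion M D = L].
Proof.
have [x0 [g0 h0]] := exists_best_letter M hX hSh.
have hD0 := le_trans h0 hD.
exists (limit_capacity M est D); split.
- exact: (block_capacity_cvg hX hest hD0).
- exact: (limit_le_capacity_distortion hX hest hD0).
(* Strictness puts the distortion of [x0] below [D], the slack that pays for dilution. *)
move=> hD'; apply/eqP; rewrite eq_le.
rewrite (capacity_distortion_le_limit hX hest hD0 (le_lt_trans h0 hD')).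
exact: (limit_le_capacity_distortion hX hest hD0).
Qed.
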